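(* Let $\epsilon\in\mathbb R$, let $I$ be an open interval, let $v : I \to \mathbb R\setminus\{0\}$ be a smooth function, and let $(u,w,x,y)$ be a solution, defined on $I$ and satisfying $u\neq 0$, $w>0$, $x>0$, $3w-y\neq 0$, $3w^2+y(2w-y)-x^2\neq0$ and $\dot w>0$ at every point, of the first order ODE system \[ \left\{ \begin{array}{l} \dot u = \epsilon + y(2w-y) - x^2 + u^2 \\[3pt] \dot w = -\dfrac{w x v}{3w-y} \\[6pt] \dot x = 2xu + yv \\[3pt] \dot y = 2u(y-w) - xv \end{array} \right. \] On $I \times \mathbb R$ define the metric $g (s, t) = ds^2 + g_{22} (s)\, dt^2$, for any $(s,t)\in I\times\mathbb R$, where $g_{22}$ is a positive solution of $\frac{d g_{22}}{ds} = - 2 u g_{22}$. Then there exists a biconservative (isometric) immersion $\varphi : (I \times \mathbb R, g) \to N^4 (\epsilon)$ such that: a) $3 f^2 + K - \epsilon \neq 0$, $H \neq 0$, $\operatorname{grad} f \neq 0$, $A_3 \neq f\, \mathrm{Id}$, $A_4 \neq 0$ and $\nabla _{E_2} E_2 \neq 0$ at any point of $I \times \mathbb R$; b) $\varphi$ has flat normal bundle and $\operatorname{grad} f$ is parallel to $\operatorname{grad} K$; c) $\nabla ^\perp _{E_1} E_3 = v E_4 \neq 0$ at any point and $\nabla ^\perp _{E_2} E_3 = 0$ on $I \times \mathbb R$, thus $\varphi$ is non-PNMC (its normalized mean curvature vector field is not parallel). Moreover, $f=f(s)=w(s)$, $k_2=k_2(s)=y(s)$, $\alpha=\alpha(s)=x(s)$,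 $a_2=a_2(s)=u(s)$ and $b_1=b_1(s)=v(s)$.
   Context: $N^4(\epsilon)$ is the 4-dimensional space form of constant sectional curvature $\epsilon$. For a surface in $N^4(\epsilon)$: $B$ is the second fundamental form, $A_\eta$ the shape operator in the normal direction $\eta$, $\nabla$ the Levi-Civita connection, $\nabla^\perp$ the normal connection, $H=\frac12\operatorname{trace}B$, $f=|H|$, $K$ the Gaussian curvature. Flat normal bundle means the curvature of $\nabla^\perp$ vanishes. Biconservative means $2\operatorname{trace}A_{\nabla^\perp_{(\cdot)}H}(\cdot)+\operatorname{grad}|H|^2=0$. The frame is $E_1=\partial/\partial s$, $E_2=g_{22}^{-1/2}\,\partial/\partial t$, $E_3=H/f$, and $E_4$ is a unit normal section orthogonal to $E_3$. Write $A_3=A_{E_3}$, $A_4=A_{E_4}$; the functions $k_1,k_2,\alpha,a_2,b_1$ are given by $A_3E_i=k_iE_i$, $A_4E_1=\alpha E_1$, $A_4E_2=-\alpha E_2$, $\nabla_{E_2}E_2=a_2E_1$, $b_1=\langle\nabla^\perp_{E_1}E_3,E_4\rangle$. The dot denotes $d/ds$. ''Parallel'' gradients means linearly dependent at every point.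
   Formalization: The clause ''A_3 ≠ f Id at any point'' fails where y = w (e.g. u=w=x=y=1, v=-1 at one point); it is replaced by: A_3 ≠ f Id at every point where y ≠ w, and the points where A_3 ≠ f Id are dense in I × R. *)

(* Defs.v *)
From HB Require Import structures.
From mathcomp Require Import all_boot all_order all_algebra.
From mathcomp Require Import all_classical all_reals all_analysis.

Set Implicit Arguments.
Unset Strict Implicit.
Unset Printing Implicit Defensive.

Import Order.TTheory GRing.Theory Num.Theory.
Import numFieldNormedType.Exports.

Local Open Scope ring_scope.
Local Open Scope classical_set_scope.

(* Maps and vector fields are total functions whose values matter only on an
   open set [U] of the coordinate plane; as [U] is open, derivatives at points
   of [U] do not depend on the values outside. *)

Section Smooth.
Context {R : realType}.

Fixpoint Cn {V : normedModType R} (n : nat) (U : set 'rV[R]_2)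
    (h : 'rV[R]_2 -> V) : Prop :=
  if n is m.+1 then
    forall i : 'I_2, (forall p, U p -> derivable h p (delta_mx 0 i)) /\
      Cn m U (fun p => 'D_(delta_mx 0 i) h p)
  else forall p, U p -> {for p, continuous h}.

Definition smooth {V : normedModType R} (U : set 'rV[R]_2)
  (h : 'rV[R]_2 -> V) : Prop := forall n, Cn n U h.

Definition smooth1 (I : set R) (h : R -> R) : Prop :=
  forall (n : nat) (s : R), I s -> derivable (h^`(n)) s 1.

End Smooth.

(* The simply connected space form of dimension 4 and curvature [eps], inside
   R^5 with its Euclidean (eps >= 0) or Lorentzian (eps < 0) product: the
   hyperplane x_0 = 0, the sphere of radius eps^(-1/2), or the upper sheet of
   the hyperboloid <x, x> = 1 / eps. *)
Section SpaceForm.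
Context {R : realType} (eps : R).

Definition dot5 (X Y : 'rV[R]_5) : R :=
  (if eps < 0 then -1 else 1) * (X 0 ord0 * Y 0 ord0)
  + \sum_(i < 4) X 0 (lift ord0 i) * Y 0 (lift ord0 i).

Definition space_form : set 'rV[R]_5 :=
  [set x : 'rV[R]_5 | if eps == 0 then x 0 ord0 = 0
           else dot5 x x = eps^-1 /\ (eps < 0 -> 0 < x 0 ord0)].

Definition space_form_tangent (x : 'rV[R]_5) : set 'rV[R]_5 :=
  [set Z : 'rV[R]_5 | if eps == 0 then Z 0 ord0 = 0 else dot5 Z x = 0].

(* Levi-Civita connection of the space form along [phi]: the component tangent
   to the space form of the derivative in R^5.  Since <x, x> = 1 / eps on the
   space form when eps <> 0, the projection is Z - eps <Z, x> x; when eps = 0,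
   derivatives of tangent fields are already tangent. *)
Definition space_form_conn (phi : 'rV[R]_2 -> 'rV[R]_5) (X : 'rV[R]_2)
    (Z : 'rV[R]_2 -> 'rV[R]_5) (p : 'rV[R]_2) : 'rV[R]_5 :=
  'D_X Z p - (eps * dot5 ('D_X Z p) (phi p)) *: phi p.

End SpaceForm.

(* A Riemannian metric in coordinates: [G p] is the Gram matrix at [p]. *)
Section Riemannian.
Context {R : realType} (G : 'rV[R]_2 -> 'M[R]_2).
Implicit Types (X Y Z : 'rV[R]_2 -> 'rV[R]_2) (p : 'rV[R]_2).

Definition metric p (a b : 'rV[R]_2) : R := (a *m G p *m b^T) 0 0.

(* The vector dual to the linear form [om]. *)
Definition sharp p (om : 'rV[R]_2 -> R) : 'rV[R]_2 :=
  \row_i \sum_(j < 2) invmx (G p) i j * om (delta_mx 0 j).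

Definition metric_trace {V : lmodType R} p
    (b : 'rV[R]_2 -> 'rV[R]_2 -> V) : V :=
  \sum_(i < 2) \sum_(j < 2) invmx (G p) i j *: b (delta_mx 0 i) (delta_mx 0 j).

Definition grad (h : 'rV[R]_2 -> R) p : 'rV[R]_2 := sharp p (fun a => 'D_a h p).

Definition christoffel (i j k : 'I_2) p : R :=
  2^-1 * \sum_(l < 2) invmx (G p) k l *
    ('D_(delta_mx 0 i) (fun q => G q j l) p
     + 'D_(delta_mx 0 j) (fun q => G q i l) p
     - 'D_(delta_mx 0 l) (fun q => G q i j) p).

Definition levi_civita X Y p : 'rV[R]_2 :=
  'D_(X p) Y p +
  \row_k \sum_(i < 2) \sum_(j < 2) X p 0 i * Y p 0 j * christoffel i j k p.

Definition lie_bracket X Y p : 'rV[R]_2 := 'D_(X p) Y p - 'D_(Y p) X p.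

Definition riemann X Y Z p : 'rV[R]_2 :=
  levi_civita X (levi_civita Y Z) p - levi_civita Y (levi_civita X Z) p
  - levi_civita (lie_bracket X Y) Z p.

Definition gauss_curvature p : R :=
  let d1 := delta_mx 0 0 : 'rV[R]_2 in
  let d2 := delta_mx 0 1 : 'rV[R]_2 in
  metric p (riemann (cst d1) (cst d2) (cst d2) p) d1 / \det (G p).

End Riemannian.

Section Immersion.
Context {R : realType} (eps : R) (U : set 'rV[R]_2) (G : 'rV[R]_2 -> 'M[R]_2)
  (phi : 'rV[R]_2 -> 'rV[R]_5).
Implicit Types (X Y : 'rV[R]_2 -> 'rV[R]_2) (eta : 'rV[R]_2 -> 'rV[R]_5).
Implicit Types (p a b : 'rV[R]_2).

Definition isometric_immersion : Prop :=
  [/\ smooth U phi,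
      forall p, U p -> space_form eps (phi p),
      forall p a, U p -> 'D_a phi p = 0 -> a = 0 &
      forall p a b, U p ->
        dot5 eps ('D_a phi p) ('D_b phi p) = metric G p a b].

Definition normal_field eta : Prop :=
  smooth U eta /\
  forall p, U p -> space_form_tangent eps (phi p) (eta p) /\
    forall a, dot5 eps (eta p) ('D_a phi p) = 0.

Definition normal_part p (Z : 'rV[R]_5) : 'rV[R]_5 :=
  Z - 'D_(sharp G p (fun a => dot5 eps Z ('D_a phi p))) phi p.

Definition second_form p a b : 'rV[R]_5 :=
  normal_part p (space_form_conn eps phi a (fun q => 'D_b phi q) p).

Definition shape_operator (n : 'rV[R]_5) p a : 'rV[R]_2 :=
  sharp G p (fun b => dot5 eps (second_form p a b) n).

Definition normal_conn X eta p : 'rV[R]_5 :=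
  normal_part p (space_form_conn eps phi (X p) eta p).

Definition normal_curvature X Y eta p : 'rV[R]_5 :=
  normal_conn X (normal_conn Y eta) p - normal_conn Y (normal_conn X eta) p
  - normal_conn (lie_bracket X Y) eta p.

Definition flat_normal_bundle : Prop :=
  forall X Y eta, smooth U X -> smooth U Y -> normal_field eta ->
  forall p, U p -> normal_curvature X Y eta p = 0.

Definition mean_curvature p : 'rV[R]_5 :=
  2^-1 *: metric_trace G p (second_form p).

Definition mean_curvature_norm p : R :=
  Num.sqrt (dot5 eps (mean_curvature p) (mean_curvature p)).

Definition unit_mean_curvature p : 'rV[R]_5 :=
  (mean_curvature_norm p)^-1 *: mean_curvature p.

Definition biconservative : Prop :=
  forall p, U p ->
    2 *: metric_trace G p
           (fun a b => shape_operator (normal_conn (cst a) mean_curvature p) p b)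
    + grad G (fun q => mean_curvature_norm q ^+ 2) p = 0.

Definition PNMC : Prop :=
  forall p a, U p -> normal_conn (cst a) unit_mean_curvature p = 0.

End Immersion.

(* Coordinates are (s, t) = (p 0 0, p 0 1). *)
Section Warped.
Context {R : realType}.

Definition strip (I : set R) : set 'rV[R]_2 := [set p | I (p 0 0)].

Definition warped_metric (g22 : R -> R) (p : 'rV[R]_2) : 'M[R]_2 :=
  diag_mx (\row_(i < 2) if i == 0 then 1 else g22 (p 0 0)).

Definition frame1 (p : 'rV[R]_2) : 'rV[R]_2 := delta_mx 0 0.

Definition frame2 (g22 : R -> R) (p : 'rV[R]_2) : 'rV[R]_2 :=
  (Num.sqrt (g22 (p 0 0)))^-1 *: delta_mx 0 1.

End Warped.

(* Main.v *)
Require Import Defs.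
From HB Require Import structures.
From mathcomp Require Import all_boot all_order all_algebra.
From mathcomp Require Import all_classical all_reals all_analysis.
From mathcomp Require Import ring lra.

(** The immersion is found together with its adapted frame. Let F be the 5 x 5
    matrix with rows phi, E1, E2, E3, E4. For a surface with the prescribed
    invariants, the derivatives of the frame are given by a linear system

       dF = (M ds + W dt) F

    whose matrices M and W (conn_s and conn_t) contain the prospective second
    fundamental form, normal connection and Christoffel symbols, and depend on
    s alone. The system is integrable when W' = M W - W M. These are the
    equations of Gauss, Codazzi and Ricci, and they amount to the equations
    for u, x, y and r = sqrt g22 (conn_t_compatible). The remaining equation,
    for w, is the biconservative condition (3 w - y) w' + w x v = 0.

    As the coefficients do not depend on t, no Frobenius theorem is needed: if
    F' = M F, then C = F^-1 W F is constant, and F(s) T(t) with T' = C T solves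
    both equations (frame_factors, moving_frame). The two linear ordinary
    equations are solved on the whole interval by Picard iteration, which
    contracts in a norm weighted by an exponential (linear_ode_solution).

    M and W are skew for D = diag(eps, 1, 1, 1, 1), so F^T D F is conserved
    (skew_flow_conserved). If the frame starts from diag(|eps|^(-1/2), 1, 1, 1, 1),
    or from diag(0, 1, 1, 1, 1) when eps = 0, this conservation law gives the
    scalar products of the frame and places phi on the space form (frame_gram,
    adapted_frame_exists).

    The geometry is then read off from the coefficients: the second fundamental
    form, mean curvature, normal connection and shape operators by dropping the
    components along phi, E1 and E2 (normal_proj), and the Gauss curvature from
    the metric alone, K = u' - u^2 (gauss_curvature_warped). The normal bundle
    is flat because in E3, E4 the normal connection is d + v(s) ds J, with J a
    constant rotation (flat_normal_bundle_frame). The gradients of f and K are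
    both multiples of E1, as f and K depend on s alone. The points where
    A3 = f Id are those with y = w; they are isolated, because there y - w has
    the derivative - x v / 2 (y_neq_w_dense). *)

Import Order.TTheory GRing.Theory Num.Theory.
Import numFieldNormedType.Exports.

Local Open Scope ring_scope.
Local Open Scope classical_set_scope.

Set Implicit Arguments.
Unset Strict Implicit.
Unset Printing Implicit Defensive.

(** * Antiderivatives and derivatives of matrices *)

Lemma is_derive_continuous (R : realType) (f : R -> R) (s d : R) :
  is_derive s 1 f d -> {for s, continuous f}.
Proof.
move=> [df _]; exact: differentiable_continuous (iffLR (derivable1_diffP _ _) df).
Qed.

Section open_interval.
Context {R : realType} {I : set R} (I_open : open I) (I_itv : is_interval I).

Lemma open_interval_enclose s s' : I s -> I s' ->
  exists a b, [/\ I a, I b, a < s < b & a < s' < b].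
Proof.
have enclose x : I x -> exists a b, [/\ I a, I b & a < x < b].
  move=> Ix; have /nbhs_ballP[e /= e0 eI] := open_nbhs_nbhs (conj I_open Ix).
  exists (x - e / 2), (x + e / 2); split.
  - apply: eI; rewrite /ball /= opprB addrCA subrr addr0 gtr0_norm ?divr_gt0//.
    lra.
  - apply: eI; rewrite /ball /= opprD addrA subrr sub0r normrN.
    by rewrite gtr0_norm ?divr_gt0//; lra.
  - by apply/andP; split; lra.
move=> /enclose[a [b [Ia Ib /andP[ax xb]]]] /enclose[c [d [Ic Id /andP[cx xd]]]].
exists (Num.min a c), (Num.max b d); split.
- by rewrite /Num.min; case: ifP.
- by rewrite /Num.max; case: ifP.
- by rewrite gt_min lt_max ax xb.
- by rewrite gt_min lt_max cx xd !orbT.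
Qed.

(** The fundamental theorem of calculus differentiates the integral from a fixed
    left endpoint. Here the base point s0 may lie on either side of s: of the
    integrals from s0 to s and from s to s0 one is over an empty or one-point
    interval, and their difference is the integral from a left endpoint a minus
    a constant. *)
Lemma antiderivative_on (f : R -> R) (s0 : R) :
  I s0 -> (forall s, I s -> {for s, continuous f}) ->
  exists F : R -> R, F s0 = 0 /\ forall s, I s -> is_derive s 1 F (f s).
Proof.
move=> Is0 cf; pose mu := @lebesgue_measure R.
have integ a b : I a -> I b -> mu.-integrable `[a, b] (EFin \o f).
  move=> Ia Ib; apply: continuous_compact_integrable.
    exact: segment_compact.
  apply: continuous_in_subspaceT => x /set_mem /=; rewrite in_itv /= => axb.
  by apply: cf; apply: I_itv axb.
pose J a b := (\int[mu]_(t in `[a, b]) f t)%R.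
exists (fun s => J s0 s - J s s0); split; first by rewrite subrr.
move=> s Is.
have [a [b [Ia Ib /andP[as_ sb] /andP[as0 s0b]]]] := open_interval_enclose Is Is0.
have [dF F's] := continuous_FTC1_closed sb (integ _ _ Ia Ib) as_ (cf _ Is).
have Jadd c d e : I c -> I e -> c <= d -> d <= e -> J c d + J d e = J c e.
  move=> Ic Ie cd de; apply/eqP; rewrite addrC eq_sym -subr_eq; apply/eqP.
  rewrite /J Rintegral_itvB//; last by apply: integ.
  rewrite Rintegral_itv_obnd_cbnd//.
  apply: (integrableS _ _ _ (integ _ _ Ic Ie)) => //.
  by apply: subset_itvr; rewrite bnd_simp.
apply: (@near_eq_is_derive _ _ _ (fun x => J a x - J a s0)).
  near=> x.
  have ax : a < x by near: x; apply: lt_nbhsr.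
  have xb : x < b by near: x; apply: lt_nbhsl.
  have Ix : I x by apply: (I_itv Ia Ib); rewrite (ltW ax) (ltW xb).
  have [s0x|xs0] := leP s0 x.
    rewrite -(Jadd a s0 x)// ?(ltW as0)// addrAC subrr add0r.
    move: s0x; rewrite le_eqVlt => /predU1P[->|s0x]; first by rewrite /J set_itv1 Rintegral_set1 subr0.
    by rewrite [X in _ = _ - X]/J set_itv_ge ?Rintegral_set0 ?subr0// -leNgt bnd_simp.
  rewrite -(Jadd a x s0)// ?(ltW ax) ?(ltW xs0)// opprD addrA subrr.
  by rewrite [X in _ = X - _]/J set_itv_ge ?Rintegral_set0 // -leNgt bnd_simp.
rewrite -[f s]subr0; apply: is_deriveB.
by rewrite -F's derive1E; exact: derivableP.
Unshelve. all: by end_near. Qed.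
End open_interval.

Section matrix_derivative.
Context {R : realType} {V : normedModType R}.
Implicit Types (t v : V).

Lemma is_derive_mxP m n (X : V -> 'M[R]_(m, n)) t v D :
  is_derive t v X D <->
  forall i j, is_derive t v (fun q => X q i j) (D i j).
Proof.
split=> [[dX <-] i j|dX].
  rewrite derive_mx// mxE; apply: derivableP.
  by have /derivable_mxP := dX; exact.
have dX' : derivable X t v.
  by apply/derivable_mxP => i j; have [] := dX i j.
apply: DeriveDef => //; rewrite derive_mx//.
by apply/matrixP => i j; rewrite mxE; have [] := dX i j.
Qed.

Lemma is_derive_mulmx m n p (X : V -> 'M[R]_(m, n)) (Y : V -> 'M[R]_(n, p))
    t v DX DY :
  is_derive t v X DX -> is_derive t v Y DY ->
  is_derive t v (fun q => X q *m Y q) (DX *m Y t + X t *m DY).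
Proof.
move=> /is_derive_mxP dX /is_derive_mxP dY; apply/is_derive_mxP => i j.
under eq_fun do rewrite mxE.
rewrite !mxE -big_split /=.
rewrite (_ : (fun q => _) = \sum_k ((fun q => X q i k) * (fun q => Y q k j))).
  apply: is_derive_sum => k; apply: (is_derive_eq (is_deriveM (dX i k) (dY k j))).
  by rewrite /GRing.scale /=; ring.
by apply/funext => q; rewrite fct_sumE.
Qed.

Lemma is_derive_trmx m n (X : V -> 'M[R]_(m, n)) t v D :
  is_derive t v X D -> is_derive t v (fun q => (X q)^T) D^T.
Proof.
move=> /is_derive_mxP dX; apply/is_derive_mxP => i j.
by under eq_fun do rewrite mxE; rewrite mxE.
Qed.

End matrix_derivative.

(** * Mean value estimates *)

Section mean_value.
Context {R : realType}.
Implicit Types (f g df dg : R -> R) (a b s : R).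

Lemma ler_derive_increment f g df dg a b : a <= b ->
  (forall s, a <= s <= b -> is_derive s 1 f (df s)) ->
  (forall s, a <= s <= b -> is_derive s 1 g (dg s)) ->
  (forall s, a <= s <= b -> df s <= dg s) ->
  f b - f a <= g b - g a.
Proof.
move=> ab dF dG le_d.
have d s : a <= s <= b -> is_derive s 1 (g - f) (dg s - df s).
  by move=> sab; apply: is_deriveB; [exact: dG|exact: dF].
have [s|s|c + E] := @MVT_segment _ (g - f) (fun s => dg s - df s) a b ab.
- by rewrite in_itv /= => /andP[/ltW as_ /ltW sb]; apply: d; rewrite as_.
- apply: continuous_in_subspaceT => {}s /set_mem /=; rewrite in_itv /= => sab.
  exact: is_derive_continuous (d _ sab).
- rewrite in_itv /= => cab; rewrite -subr_ge0.
  rewrite (_ : _ - _ = (g - f) b - (g - f) a); last by rewrite !fctE; ring.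
  by rewrite E mulr_ge0 ?subr_ge0// le_d.
Qed.

Lemma derive0_constant (I : set R) f : is_interval I ->
  (forall s, I s -> is_derive s 1 f 0) ->
  forall s s', I s -> I s' -> f s = f s'.
Proof.
move=> I_itv df; suff H s s' : I s -> I s' -> s <= s' -> f s = f s'.
  by move=> s s' Is Is'; case: (leP s s') => [|/ltW] ?; [|apply/esym]; exact: H.
move=> Is Is' ss'.
have dI x : s <= x <= s' -> is_derive x 1 f 0.
  by move=> xI; apply: df; apply: I_itv xI.
have d0 x : s <= x <= s' -> is_derive x 1 (cst 0 : R -> R) 0.
  by move=> _; exact: is_derive_cst.
have := ler_derive_increment ss' dI d0 (fun _ _ => lexx _).
have := ler_derive_increment ss' d0 dI (fun _ _ => lexx _).
by rewrite /cst subrr => l1 l2; apply/eqP; rewrite eq_sym -subr_eq0 eq_le l1 l2.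
Qed.

(** Integrating the weight exp(l |s - s0|) divides it by l: for large l,
    integration is a contraction in the weighted norm, however long the interval
    is. *)
Lemma exp_weighted_bound g dg a b s0 (m l : R) :
  0 <= m -> 0 < l -> a <= s0 <= b -> g s0 = 0 ->
  (forall s, a <= s <= b -> is_derive s 1 g (dg s)) ->
  (forall s, a <= s <= b -> `|dg s| <= m * expR (l * `|s - s0|)) ->
  forall s, a <= s <= b -> `|g s| <= m / l * expR (l * `|s - s0|).
Proof.
move=> m0 l0 /andP[as0 s0b] gs0 dG bound s /andP[as_ sb].
have ml0 : 0 <= m / l by rewrite divr_ge0 // ltW.
pose h (e : R) (x : R) := e * (m / l) * expR (l * (e * (x - s0))).
have dh (e x : R) : e * e = 1 ->
    is_derive x 1 (h e) (m * expR (l * (e * (x - s0)))).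
  move=> ee; rewrite /h.
  have dlin : is_derive x 1 (fun x => l * (e * (x - s0))) (l * e).
    rewrite (_ : (fun x => _) = (l * e) \*: (id - cst s0)); last first.
      by apply/funext => z; rewrite /= !fctE /GRing.scale /= mulrA.
    apply: (is_derive_eq (is_deriveZ _ _)).
    by rewrite subr0 /GRing.scale /= mulr1.
  have dexp := @is_derive1_comp R expR (fun x => l * (e * (x - s0))) x _ _
    (is_derive_expR _) dlin.
  apply: (is_derive_eq (is_deriveZ (e * (m / l)) dexp)).
  rewrite /GRing.scale /=.
  rewrite (_ : e * _ * _ = e * e * (m * expR (l * (e * (x - s0))))).
    by rewrite ee mul1r.
  by field; rewrite gt_eqF.
have dN x : a <= x <= b -> is_derive x 1 (- g) (- dg x).
  by move=> xab; apply: is_deriveN; exact: dG.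
have [s0s|/ltW ss0] := leP s0 s.
- have sub x : s0 <= x <= s -> a <= x <= b.
    by move=> /andP[? ?]; apply/andP; split; [exact: le_trans as0 _|exact: le_trans sb].
  have dh1 x : s0 <= x <= s -> is_derive x 1 (h 1) (m * expR (l * (1 * (x - s0)))).
    by move=> _; apply: dh; rewrite mulr1.
  have bd x : s0 <= x <= s -> `|dg x| <= m * expR (l * (1 * (x - s0))).
    move=> xs; apply: le_trans (bound _ (sub _ xs)) _.
    by move/andP: xs => [? ?]; rewrite mul1r ger0_norm// subr_ge0.
  have bdN x (xs : s0 <= x <= s) : `|- dg x| <= _ := eq_ind_r (fun z => z <= _) (bd x xs) (normrN _).
  have U1 := ler_derive_increment s0s (fun x xs => dG _ (sub _ xs)) dh1
    (fun x xs => ler_normlW (bd _ xs)).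
  have U2 := ler_derive_increment s0s (fun x xs => dN _ (sub _ xs)) dh1
    (fun x xs => ler_normlW (bdN _ xs)).
  move: U1 U2; rewrite /h !fctE !gs0 !mul1r subrr mulr0 expR0 !subr0 oppr0 subr0.
  rewrite (ger0_norm (x := s - s0)) ?subr_ge0// => U1 U2.
  by rewrite ler_norml; apply/andP; split; lra.
- have sub x : s <= x <= s0 -> a <= x <= b.
    by move=> /andP[? ?]; apply/andP; split; [exact: le_trans as_ _|exact: le_trans s0b].
  have dh1 x : s <= x <= s0 -> is_derive x 1 (h (-1)) (m * expR (l * (-1 * (x - s0)))).
    by move=> _; apply: dh; rewrite mulrNN mulr1.
  have bd x : s <= x <= s0 -> `|dg x| <= m * expR (l * (-1 * (x - s0))).
    move=> xs; apply: le_trans (bound _ (sub _ xs)) _.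
    by move/andP: xs => [? ?]; rewrite mulN1r ler0_norm// subr_le0.
  have bdN x (xs : s <= x <= s0) : `|- dg x| <= _ := eq_ind_r (fun z => z <= _) (bd x xs) (normrN _).
  have U1 := ler_derive_increment ss0 (fun x xs => dG _ (sub _ xs)) dh1
    (fun x xs => ler_normlW (bd _ xs)).
  have U2 := ler_derive_increment ss0 (fun x xs => dN _ (sub _ xs)) dh1
    (fun x xs => ler_normlW (bdN _ xs)).
  move: U1 U2; rewrite /h !fctE !gs0 subrr !mulr0 expR0 !sub0r.
  rewrite (ler0_norm (x := s - s0)) ?subr_le0// !mulN1r => U1 U2.
  by rewrite ler_norml; apply/andP; split; lra.
Qed.

End mean_value.

(** * Linear differential equations *)

Section geometric.
Context {R : realType}.

Lemma geometric_small (C e : R) : 0 < e -> exists N, C / 2 ^+ N < e.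
Proof.
move=> e0; have := @cvg_geometric R C 2^-1.
rewrite gtr0_norm ?invf_lt1 ?ltr1n//.
move=> /(_ isT)/cvgrPdist_lt/(_ e e0)[N _ /(_ N (leqnn N))] /=.
by rewrite sub0r normrN exprVn => /ltr_normlW ?; exists N.
Qed.

(** The limit comes with an explicit rate: applied to functions entry by entry
    with one constant C, this serves as uniform convergence. *)
Lemma geometric_cvg (u : nat -> R) (C : R) :
  (forall k, `|u k.+1 - u k| <= C / 2 ^+ k) ->
  forall k, `|limn u - u k| <= 2 * C / 2 ^+ k.
Proof.
move=> uC.
have C0 : 0 <= C by apply: le_trans (normr_ge0 _) _; rewrite -[leRHS]divr1; exact: uC 0%N.
have tail k m : `|u (k + m)%N - u k| <= 2 * C / 2 ^+ k - 2 * C / 2 ^+ (k + m).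
  elim: m => [|m IH]; first by rewrite addn0 !subrr normr0.
  rewrite addnS -(subrKA (u (k + m)%N)) (le_trans (ler_normD _ _))//.
  rewrite (le_trans (lerD (uC _) IH))// exprS.
  have : 2 ^+ (k + m) != 0 :> R by rewrite expf_neq0.
  have : 2 ^+ k != 0 :> R by rewrite expf_neq0.
  move: (2 ^+ (k + m)) (2 ^+ k) => z t t0 z0.
  by rewrite le_eqVlt; apply/orP; left; apply/eqP; field; rewrite t0 z0.
have cvgu : cvgn u.
  apply: cauchy_cvg; apply/cauchy_ballP => e e0.
  have [N NP] := geometric_small (4 * C) e0.
  exists (u @` [set n | (N <= n)%N], u @` [set n | (N <= n)%N]).
    by split; exists N => // n Nn; exists n.
  move=> [_ _] [/= [p Np <-] [q Nq <-]].
  rewrite /ball /= -(subrKA (u N)).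
  rewrite (le_lt_trans (ler_normD _ _))//.
  have tp r : (N <= r)%N -> `|u r - u N| <= 2 * C / 2 ^+ N.
    move=> /subnKC <-; rewrite (le_trans (tail _ _))// gerBl.
    by rewrite divr_ge0 ?mulr_ge0// exprn_ge0.
  rewrite (distrC (u N)) (le_lt_trans (lerD (tp _ Np) (tp _ Nq)))//.
  by rewrite -mulrDl -mulrDl -natrD.
move=> k.
have cv : (fun n => `|u n - u k|) @ \oo --> `|limn u - u k|.
  by apply: cvg_norm; apply: cvgB => //; exact: cvg_cst.
rewrite -(cvg_lim _ cv)//; apply: limr_le; first exact: cvgP cv.
exists k => // n /= /subnKC <-; rewrite (le_trans (tail _ _))// gerBl.
by rewrite divr_ge0 ?mulr_ge0// exprn_ge0.
Qed.

Lemma eq0_le_geometric (z C : R) : (forall k, `|z| <= C / 2 ^+ k) -> z = 0.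
Proof.
move=> zC; apply/eqP; rewrite -normr_le0; apply/ler_addgt0Pr => e e0.
have [N NP] := geometric_small C e0.
by rewrite add0r (le_trans (zC N))// ltW.
Qed.
End geometric.

Section linear_ode.
Context {R : realType} {I : set R} (I_open : open I) (I_itv : is_interval I).

Definition continuous_mx_on m n (A : R -> 'M[R]_(m, n)) :=
  forall s i j, I s -> {for s, continuous (fun s => A s i j)}.

Lemma continuous_mulmx_on m n p (A : R -> 'M[R]_(m, n)) (B : R -> 'M[R]_(n, p)) :
  continuous_mx_on A -> continuous_mx_on B ->
  continuous_mx_on (fun s => A s *m B s).
Proof.
move=> cA cB s i j Is.
rewrite (_ : (fun s => _) = \sum_k ((fun s => A s i k) * (fun s => B s k j))).
  elim/big_ind: _ => [|f g|k _]; first exact: cst_continuous.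
    exact: continuousD.
  by apply: continuousM; [exact: cA|exact: cB].
by apply/funext => x; rewrite mxE fct_sumE.
Qed.

Lemma continuous_mx_on_bounded m n (A : R -> 'M[R]_(m, n)) a b :
  continuous_mx_on A -> I a -> I b ->
  exists2 K : R, 0 <= K & forall s i j, a <= s <= b -> `|A s i j| <= K.
Proof.
move=> cA Ia Ib.
have /choice[K KP] : forall ij : 'I_m * 'I_n, exists K : R,
    forall s, a <= s <= b -> `|A s ij.1 ij.2| <= K.
  move=> [i j].
  have ct : {within `[a, b], continuous (fun s => A s i j)}.
    apply: continuous_in_subspaceT => s /set_mem /=; rewrite in_itv /= => sab.
    by apply: cA; apply: I_itv sab.
  have /compact_bounded[M [_ MP]] := continuous_compact ct (@segment_compact _ a b).
  exists (M + 1) => s sab; apply: MP; first by rewrite ltrDl.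
  by exists s.
exists (\sum_ij `|K ij|); first by apply: sumr_ge0.
move=> s i j sab; rewrite (bigD1 (i, j)) //=.
rewrite (le_trans (KP (i, j) _ sab))// (le_trans (ler_norm _))// lerDl.
exact: sumr_ge0.
Qed.

Lemma is_derive_continuous_mx_on m n (X DX : R -> 'M[R]_(m, n)) :
  (forall s, I s -> is_derive s 1 X (DX s)) -> continuous_mx_on X.
Proof.
move=> dX s i j Is; have /is_derive_mxP/(_ i j) := dX s Is.
exact: is_derive_continuous.
Qed.

Lemma mx_antiderivative_on m n (B : R -> 'M[R]_(m, n)) s0 :
  I s0 -> continuous_mx_on B ->
  exists Z, Z s0 = 0 /\ forall s, I s -> is_derive s 1 Z (B s).
Proof.
move=> Is0 cB.
have /choice[F FP] (ij : 'I_m * 'I_n) :=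
  antiderivative_on I_open I_itv Is0 (fun s => cB s ij.1 ij.2).
exists (fun s => \matrix_(i, j) F (i, j) s); split.
  by apply/matrixP => i j; rewrite !mxE; have [] := FP (i, j).
move=> s Is; apply/is_derive_mxP => i j.
under eq_fun do rewrite mxE.
by have [_ /(_ s Is)] := FP (i, j).
Qed.

Lemma mulmx_entry_bound n p (A : 'M[R]_n) (B : 'M[R]_(n, p)) (K q : R) i j :
  0 <= K -> (forall k, `|A i k| <= K) -> (forall k, `|B k j| <= q) ->
  `|(A *m B) i j| <= n%:R * K * q.
Proof.
move=> K0 AK Bq; rewrite mxE (le_trans (ler_norm_sum _ _ _))//.
rewrite (@le_trans _ _ (\sum_(k < n) K * q))//; last first.
  by rewrite sumr_const card_ord -mulrA mulr_natl.
by apply: ler_sum => k _; rewrite normrM ler_pM.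
Qed.

(** One Picard sequence is built on all of I. It contracts, in a weighted norm,
    on every compact subinterval containing s0, so that it converges on all of I
    to a fixed point of the integral operator. *)
Theorem linear_ode_solution n p (A : R -> 'M[R]_n) (P : 'M[R]_(n, p)) s0 :
  I s0 -> continuous_mx_on A ->
  exists X, X s0 = P /\ forall s, I s -> is_derive s 1 X (A s *m X s).
Proof.
move=> Is0 cA.
have /choice[next nextP] : forall Y : R -> 'M[R]_(n, p), exists Z,
    continuous_mx_on Y ->
    Z s0 = 0 /\ forall s, I s -> is_derive s 1 Z (A s *m Y s).
  move=> Y; have [cY|ncY] := pselect (continuous_mx_on Y); last by exists (cst 0).
  have [Z ZP] := mx_antiderivative_on Is0 (continuous_mulmx_on cA cY).
  by exists Z.
have next0 Y : continuous_mx_on Y -> next Y s0 = 0 by move=> /nextP[].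
have dnext Y s : continuous_mx_on Y -> I s ->
    is_derive s 1 (next Y) (A s *m Y s) by move=> /nextP[_]; exact.
have cnext Y : continuous_mx_on Y -> continuous_mx_on (next Y).
  by move=> /nextP[_]; exact: is_derive_continuous_mx_on.
pose S := fix S k := if k is k'.+1 then (fun s => P + next (S k') s) else cst P.
have cS k : continuous_mx_on (S k).
  elim: k => [|k IH] s i j Is /=.
    by rewrite /cst; exact: cst_continuous.
  rewrite (_ : (fun s => _) = cst (P i j) + (fun s => next (S k) s i j)).
    by apply: continuousD; [exact: cst_continuous|exact: cnext].
  by apply/funext => x; rewrite mxE.
(* One application of the integral operator halves the weighted norm
   sup e^(-l|s - s0|) |Y(s)| once l is twice the bound of A. *)
have contract a b : I a -> I b -> a <= s0 <= b -> exists2 l : R, 0 <= l &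
    forall (Y Z : R -> 'M[R]_(n, p)) (q : R), 0 <= q -> Z s0 = 0 ->
    (forall s, I s -> is_derive s 1 Z (A s *m Y s)) ->
    (forall s i j, a <= s <= b -> `|Y s i j| <= q * expR (l * `|s - s0|)) ->
    forall s i j, a <= s <= b -> `|Z s i j| <= q / 2 * expR (l * `|s - s0|).
  move=> Ia Ib s0ab; have [K K0 KP] := continuous_mx_on_bounded cA Ia Ib.
  pose l := 2 * (n%:R * K + 1).
  have nK0 : 0 <= n%:R * K by rewrite mulr_ge0.
  have l0 : 0 < l by rewrite /l mulr_gt0// ltr_wpDl.
  exists l; first exact: ltW.
  move=> Y Z q q0 Zs0 dZ Yq s i j sab.
  have sI x : a <= x <= b -> I x by move=> xab; apply: I_itv xab.
  have := @exp_weighted_bound R (fun x => Z x i j)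
    (fun x => (A x *m Y x) i j) a b s0 (n%:R * K * q) l.
  move=> /(_ (mulr_ge0 nK0 q0) l0 s0ab).
  rewrite Zs0 mxE => /(_ erefl _ _ s sab) H.
  apply: le_trans (H _ _) _.
  - move=> x xab; have /is_derive_mxP := dZ _ (sI _ xab); exact.
  - move=> x xab; rewrite -[leRHS]mulrA; apply: mulmx_entry_bound => // k.
      exact: KP.
    exact: Yq.
  rewrite ler_wpM2r ?expR_ge0// ler_pdivrMr// /l.
  rewrite mulrA divfK ?pnatr_eq0// mulrDr mulr1 [leRHS]addrC -lerBlDr.
  by rewrite [q * _]mulrC subrr.
pose D k s : 'M[R]_(n, p) := S k.+1 s - S k s.
have dD k s : I s -> is_derive s 1 (D k.+1) (A s *m D k s).
  move=> Is; rewrite /D mulmxBr.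
  rewrite (_ : (fun s => _) = next (S k.+1) - next (S k)); last first.
    by apply/funext => x; rewrite /= !fctE opprD addrACA subrr add0r.
  by apply: is_deriveB; [exact: dnext (cS k.+1) Is|exact: dnext (cS k) Is].
have D0 k : D k.+1 s0 = 0.
  by rewrite /D /= (next0 _ (cS k)) (next0 _ (cS k.+1)) subrr.
pose X s := \matrix_(i, j) limn (fun k => S k s i j).
have [c c0 cP] : exists2 c : R, 0 <= c & forall i j, `|P i j| <= c.
  exists (\sum_i \sum_j `|P i j|); first by do 2![apply: sumr_ge0 => ? _].
  move=> i j; rewrite (bigD1 i)//= (bigD1 j)//= -addrA lerDl.
  by rewrite addr_ge0//; do 2?[apply: sumr_ge0 => ? _].
have approx a b : I a -> I b -> a <= s0 <= b -> exists2 C : R, 0 <= C &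
    forall s k i j, a <= s <= b -> `|X s i j - S k s i j| <= C / 2 ^+ k.
  move=> Ia Ib s0ab; have [l l0 lP] := contract _ _ Ia Ib s0ab.
  have Dbound k s i j : a <= s <= b ->
      `|D k s i j| <= c / 2 ^+ k.+1 * expR (l * `|s - s0|).
    elim: k s i j => [|k IH] s i j sab.
      have dD0 x : I x -> is_derive x 1 (D 0%N) (A x *m cst P x).
        move=> Ix; rewrite /D /=.
        rewrite (_ : (fun s => _) = next (cst P)); first exact: dnext (cS 0%N) Ix.
        by apply/funext => z; rewrite /cst addrAC subrr add0r.
      have D00 : D 0%N s0 = 0.
        by rewrite /D /= (next0 _ (cS 0%N)) addr0 subrr.
      rewrite expr1; apply: (lP _ _ c c0 D00 dD0 _ s i j sab) => x i' j' _.
      rewrite (le_trans (cP i' j'))// ler_peMr//.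
      by rewrite -expR0 ler_expR mulr_ge0.
    rewrite [in leRHS]exprSr invfM mulrA.
    have ck : 0 <= c / 2 ^+ k.+1 by rewrite divr_ge0// exprn_ge0.
    exact: (lP _ _ _ ck (D0 k) (dD k) IH s i j sab).
  have ba0 : 0 <= b - a.
    by move/andP: s0ab => [as0 s0b]; rewrite subr_ge0 (le_trans as0 s0b).
  exists (c * expR (l * (b - a))); first by rewrite mulr_ge0// expR_ge0.
  move=> s k i j sab; rewrite mxE.
  rewrite (_ : c * _ = 2 * (c / 2 * expR (l * (b - a)))); last by field.
  apply: (@geometric_cvg _ (fun k => S k s i j)) => m.
  have -> : S m.+1 s i j - S m s i j = D m s i j by rewrite /D !mxE.
  apply: le_trans (Dbound _ _ _ _ sab) _.
  rewrite exprS invfM mulrA mulrAC ler_wpM2r ?invr_ge0 ?exprn_ge0//.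
  rewrite ler_wpM2l ?divr_ge0// ler_expR ler_wpM2l//.
  by move/andP: sab s0ab => [? ?] /andP[? ?]; rewrite ler_norml; apply/andP; split; lra.
have cX : continuous_mx_on X.
  move=> s i j Is.
  have [a [b [Ia Ib /andP[as_ sb] /andP[as0 s0b]]]] :=
    open_interval_enclose I_open Is Is0.
  have s0ab : a <= s0 <= b by rewrite !ltW.
  have [C C0 CP] := approx _ _ Ia Ib s0ab.
  apply/cvgrPdist_le => e e0.
  have e3 : 0 < e / 3 by rewrite divr_gt0.
  have [N /ltW NP] := geometric_small C e3.
  have /cvgrPdist_le/(_ (e / 3)) := cS N s i j Is.
  rewrite divr_gt0// => /(_ isT) Se.
  near=> x.
  have xab : a <= x <= b.
    by apply/andP; split; apply: ltW; near: x; [exact: lt_nbhsr|exact: lt_nbhsl].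
  have sab : a <= s <= b by rewrite !ltW.
  have H1 := le_trans (CP s N i j sab) NP.
  have H2 := le_trans (CP x N i j xab) NP.
  have H3 : `|S N s i j - S N x i j| <= e / 3 by near: x.
  rewrite -(subrKA (S N s i j)) (le_trans (ler_normD _ _))//.
  rewrite -[S N s i j - _](subrKA (S N x i j)).
  move: H2; rewrite distrC => H2.
  rewrite (le_trans (lerD H1 (le_trans (ler_normD _ _) (lerD H3 H2))))//.
  lra.
exists (fun s => P + next X s); split.
  by rewrite (next0 _ cX) addr0.
move=> s Is.
suff <- : X s = P + next X s.
  rewrite -[A s *m X s]add0r.
  exact: (is_deriveD (is_derive_cst P s 1) (dnext _ _ cX Is)).
have [a [b [Ia Ib /andP[as_ sb] /andP[as0 s0b]]]] :=
  open_interval_enclose I_open Is Is0.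
have s0ab : a <= s0 <= b by rewrite !ltW.
have sab : a <= s <= b by rewrite !ltW.
have [C C0 CP] := approx _ _ Ia Ib s0ab.
have [l l0 lP] := contract _ _ Ia Ib s0ab.
apply/matrixP => i j; apply/eqP; rewrite -subr_eq0; apply/eqP.
apply: (@eq0_le_geometric _ _ (C / 2 + C / 2 * expR (l * `|s - s0|))) => k.
have := lP (fun s => S k s - X s) (fun s => next (S k) s - next X s) (C / 2 ^+ k).
have dZ x : I x -> is_derive x 1 (fun s => next (S k) s - next X s)
    (A x *m (S k x - X x)).
  move=> Ix; rewrite mulmxBr.
  by apply: is_deriveB; [exact: dnext (cS k) Ix|exact: dnext cX Ix].
rewrite (next0 _ (cS k)) (next0 _ cX) subrr divr_ge0 ?exprn_ge0//.
move=> /(_ isT erefl dZ) H; have {}H := H _ s i j sab.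
rewrite -(subrKA (S k.+1 s i j)) (le_trans (ler_normD _ _))// mulrDl lerD//.
  by have := CP s k.+1 i j sab; rewrite exprS invfM mulrA.
rewrite [leRHS]mulrAC [C / 2 / _]mulrAC.
rewrite (_ : S k.+1 s i j - _ = (next (S k) s - next X s) i j); last first.
  by rewrite /= !mxE; ring.
apply: H => x i' j' xab; rewrite !mxE distrC.
have := CP x k i' j' xab; rewrite mxE => /le_trans; apply.
by rewrite ler_peMr ?divr_ge0 ?exprn_ge0// -expR0 ler_expR mulr_ge0.
Unshelve. all: by end_near. Qed.

End linear_ode.

(** * Differentiability and mixed derivatives in the plane *)

Section plane_calculus.
Context {R : realType}.
Implicit Types (p q d : 'rV[R]_2) (U : set 'rV[R]_2).

Local Notation e_ i := (delta_mx 0 i : 'rV[R]_2).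

Lemma rV2_decomp d : d = d 0 0 *: e_ 0 + d 0 1 *: e_ 1.
Proof.
apply/rowP => j; rewrite !mxE /=.
by case: j => [[|[|//]]] ? /=; rewrite ?mulr1 ?mulr0 ?addr0 ?add0r;
  congr (d _ _); exact/val_inj.
Qed.

Lemma nbhs_rV2P p (A : set 'rV[R]_2) : nbhs p A ->
  exists2 e : R, 0 < e & forall q, (forall i, `|q 0 i - p 0 i| < e) -> A q.
Proof.
move=> /nbhs_ballP[e /= e0 eA]; exists e => // q qe; apply: eA.
split=> // i j; rewrite /ball /= ord1 distrC; exact: qe.
Qed.

Lemma is_derive_line {V : normedModType R} (h : 'rV[R]_2 -> V) v q (a : R) :
  derivable h (a *: v + q) v ->
  is_derive a 1 (fun b => h (b *: v + q)) ('D_v h (a *: v + q)).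
Proof.
move=> dh; have E : (fun k => k^-1 *: (((fun b => h (b *: v + q)) \o shift a) (k *: 1)
    - h (a *: v + q))) =
    (fun k => k^-1 *: ((h \o shift (a *: v + q)) (k *: v) - h (a *: v + q))).
  apply/funext => k /=.
  by rewrite -[k *: 1]/(k * 1) mulr1 scalerDl addrA.
by split; rewrite /derivable /derive E.
Qed.

Lemma mean_value_around (g dg : R -> R) (c : R) :
  (forall s : R, `|s| <= `|c| -> is_derive s 1 g (dg s)) ->
  exists2 x : R, `|x| <= `|c| & g c - g 0 = c * dg x.
Proof.
move=> dG; have cont (a b : R) : (forall s : R, a <= s <= b -> `|s| <= `|c|) ->
    {within `[a, b], continuous g}.
  move=> sub; apply: continuous_in_subspaceT => s /set_mem /=.
  by rewrite in_itv /= => /sub/dG; exact: is_derive_continuous.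
have [c0|/ltW c0] := leP 0 c.
- have sub (s : R) : 0 <= s <= c -> `|s| <= `|c| by move=> /andP[? ?]; rewrite !ger0_norm.
  have [s|x xc E] := @MVT_segment _ g dg 0 c c0 _ (cont _ _ sub).
    by rewrite in_itv /= => /andP[/ltW s0 /ltW sc]; apply/dG/sub; rewrite s0.
  exists x; last by rewrite E subr0 mulrC.
  by apply: sub; move: xc; rewrite in_itv.
- have sub (s : R) : c <= s <= 0 -> `|s| <= `|c|.
    by move=> /andP[? ?]; rewrite !ler0_norm// lerN2.
  have [s|x xc E] := @MVT_segment _ g dg c 0 c0 _ (cont _ _ sub).
    by rewrite in_itv /= => /andP[/ltW s0 /ltW sc]; apply/dG/sub; rewrite s0.
  exists x; first by apply: sub; move: xc; rewrite in_itv.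
  by rewrite -[LHS]opprB E sub0r mulrN opprK mulrC.
Qed.

Lemma mean_value_line (h : 'rV[R]_2 -> R) v q (c : R) :
  (forall s : R, `|s| <= `|c| -> derivable h (s *: v + q) v) ->
  exists2 x : R, `|x| <= `|c| & h (c *: v + q) - h q = c * 'D_v h (x *: v + q).
Proof.
move=> dh; have [x xc E] := mean_value_around (fun s sc => is_derive_line (dh s sc)).
by exists x => //; rewrite -E scale0r add0r.
Qed.

(** An increment of h is split into one increment along each axis; the mean value
    theorem turns each into a partial derivative at a point close to p. *)
Lemma C1_differentiable U (h : 'rV[R]_2 -> R) p : open U -> U p ->
  (forall i q, U q -> derivable h q (e_ i)) ->
  (forall i, {for p, continuous (fun q => 'D_(e_ i) h q)}) ->
  differentiable h p.
Proof.
move=> oU Up dh ch.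
pose g (d : 'rV[R]_2) : R := d 0 0 * 'D_(e_ 0) h p + d 0 1 * 'D_(e_ 1) h p.
have g_lin : linear g.
  move=> a x z; rewrite /g !mxE /GRing.scale /=.
  move: ('D_(e_ 0) h p) ('D_(e_ 1) h p) => A B; ring.
pose f : {linear 'rV[R]_2 -> R} := HB.pack g (GRing.isLinear.Build _ _ _ _ _ g_lin).
have cf : continuous f.
  move=> d.
  have c i A : {for d, continuous (fun x : 'rV[R]_2 => x 0 i * A : R)}.
    apply: (@continuousM _ _ (fun x : 'rV[R]_2 => x 0 i : R) (cst A) d).
      exact: coord_continuous.
    exact: cst_continuous.
  exact: (@continuousD _ _ _ (fun x : 'rV[R]_2 => x 0 0 * _ : R)
    (fun x : 'rV[R]_2 => x 0 1 * _ : R) d (c 0 _) (c 1 _)).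
have fo : h \o shift p = (cst (h p) : 'rV[R]_2 -> R) + (f : 'rV[R]_2 -> R) +o_ (0 : 'rV[R]_2) id.
  apply/eqaddoP => e e0.
  have e20 : 0 < e / 2 by rewrite divr_gt0.
  have near_i i : \forall q \near p, U q /\ `|'D_(e_ i) h p - 'D_(e_ i) h q| <= e / 2.
    near=> q; split; first by near: q; exact: open_nbhs_nbhs.
    near: q; move: (ch i) => /cvgrPdist_le; exact.
  have [r r0 rP] := nbhs_rV2P (filterI (near_i 0) (near_i 1)).
  apply/nbhs_ballP; exists r => //= d [_ dr].
  have d0r : `|d 0 0| < r by have := dr 0 0; rewrite /ball /= mxE sub0r normrN.
  have d1r : `|d 0 1| < r by have := dr 0 1; rewrite /ball /= mxE sub0r normrN.
  have small (a b : R) : `|a| <= `|d 0 0| -> `|b| <= `|d 0 1| ->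
      forall i, `|(a *: e_ 0 + (b *: e_ 1 + p)) 0 i - p 0 i| < r.
    move=> ad bd i; rewrite !mxE /= addrA addrK.
    case: i => [[|[|//]]] ? /=; rewrite ?mulr1 ?mulr0 ?addr0 ?add0r.
      exact: le_lt_trans ad d0r.
    exact: le_lt_trans bd d1r.
  have [x xd Ex] := @mean_value_line h (e_ 0) (d 0 1 *: e_ 1 + p) (d 0 0)
    (fun s sd => dh 0 _ (rP _ (small s (d 0 1) sd (lexx _))).1.1).
  have [z zd Ez] : exists2 z : R, `|z| <= `|d 0 1| &
      h (d 0 1 *: e_ 1 + p) - h p = d 0 1 * 'D_(e_ 1) h (z *: e_ 1 + p).
    apply: mean_value_line => s sd; apply: dh.
    have := (rP _ (small 0 s _ sd)).1.1; rewrite scale0r add0r; apply.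
    by rewrite normr0.
  have Bx := (rP _ (small x (d 0 1) xd (lexx _))).1.2.
  have Bz : `|'D_(e_ 1) h p - 'D_(e_ 1) h (z *: e_ 1 + p)| <= e / 2.
    have := (rP _ (small 0 z _ zd)).2.2; rewrite scale0r add0r; apply.
    by rewrite normr0.
  have -> : (h \o shift p - (cst (h p) + (g : _ -> R))) d =
     h (d 0 0 *: e_ 0 + (d 0 1 *: e_ 1 + p)) - (h p + g d).
    transitivity (h (d + p) - (h p + g d)); first by [].
    by rewrite {1}[d]rV2_decomp -addrA.
  rewrite /g.
  have -> : h (d 0 0 *: e_ 0 + (d 0 1 *: e_ 1 + p)) -
     (h p + (d 0 0 * 'D_(e_ 0) h p + d 0 1 * 'D_(e_ 1) h p)) =
     - (d 0 0 * ('D_(e_ 0) h p - 'D_(e_ 0) h (x *: e_ 0 + (d 0 1 *: e_ 1 + p)))) -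
     d 0 1 * ('D_(e_ 1) h p - 'D_(e_ 1) h (z *: e_ 1 + p)).
    rewrite !mulrBr -Ex -Ez; ring.
  have dle i : `|d 0 i| <= `|d|.
    rewrite [leRHS]/Num.Def.normr /= mx_normrE.
    exact: (le_bigmax _ (fun ij => `|d ij.1 ij.2|) (0, i)).
  rewrite (le_trans (ler_normB _ _))// normrN !normrM.
  rewrite (_ : e * `|d| = `|d| * (e / 2) + `|d| * (e / 2)); last by field.
  by rewrite lerD// ler_pM.
have dE := diff_unique cf fo.
by apply/diff_locallyP; rewrite dE.
Unshelve. all: by end_near. Qed.

Lemma differentiable_derive2 {V : normedModType R} (h : 'rV[R]_2 -> V) p d :
  differentiable h p -> 'D_d h p = d 0 0 *: 'D_(e_ 0) h p + d 0 1 *: 'D_(e_ 1) h p.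
Proof.
move=> dh; rewrite !deriveE// [d in LHS]rV2_decomp.
by rewrite linearD !linearZ.
Qed.

(** The second difference of h over a square. It is symmetric in the two
    directions, and it is t^2 times a mixed derivative at a nearby point, taken
    in either order: that is why mixed derivatives commute. *)
Definition square_increment (h : 'rV[R]_2 -> R) i j p (t : R) : R :=
  h (t *: e_ i + (t *: e_ j + p)) - h (t *: e_ j + p)
  - (h (t *: e_ i + p) - h p).

Lemma square_incrementC h i j p t :
  square_increment h i j p t = square_increment h j i p t.
Proof. by rewrite /square_increment addrCA; ring. Qed.

Lemma dist_split (a b c e : R) :
  `|a - c| <= e / 2 -> `|b - c| <= e / 2 -> `|a - b| <= e.
Proof.
rewrite !ler_distl => /andP[? ?] /andP[? ?].
by apply/andP; split; lra.
Qed.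

Lemma square_mixed_derive U (h : 'rV[R]_2 -> R) i j p (t r : R) :
  0 < t -> t < r -> i != j ->
  (forall q, (forall k, `|q 0 k - p 0 k| < r) -> U q) ->
  (forall q, U q -> derivable h q (e_ i)) ->
  (forall q, U q -> derivable (fun x => 'D_(e_ i) h x) q (e_ j)) ->
  exists2 q : 'rV[R]_2, forall k, `|q 0 k - p 0 k| <= t &
    square_increment h i j p t = t * (t * 'D_(e_ j) (fun x => 'D_(e_ i) h x) q).
Proof.
move=> t0 tr ij rU dh ddh.
have close (a b : R) : `|a| <= t -> `|b| <= t ->
    forall k, `|(b *: e_ j + (a *: e_ i + p)) 0 k - p 0 k| <= t.
  move=> at_ bt k; rewrite !mxE /= addrA addrK.
  have [->|ki] := eqVneq k i.
    by rewrite (negPf ij) mulr0 add0r mulr1.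
  by rewrite mulr0 addr0; case: eqVneq => _; rewrite ?mulr1 ?mulr0 ?normr0 // ltW.
have closeU (a b : R) : `|a| <= t -> `|b| <= t -> U (b *: e_ j + (a *: e_ i + p)).
  by move=> at_ bt; apply: rU => k; apply: le_lt_trans tr; exact: close.
have t_norm : `|t| = t by rewrite gtr0_norm.
have n0 : `|0 : R| <= t by rewrite normr0 ltW.
pose g (a : R) : R := h (a *: e_ i + (t *: e_ j + p)) - h (a *: e_ i + p).
have dg (a : R) : `|a| <= `|t| -> is_derive a 1 g
    ('D_(e_ i) h (a *: e_ i + (t *: e_ j + p)) - 'D_(e_ i) h (a *: e_ i + p)).
  rewrite t_norm => at_; apply: is_deriveB; apply/is_derive_line/dh.
    by rewrite addrCA; apply: closeU; rewrite // t_norm.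
  by rewrite -[_ + p]add0r -(scale0r (e_ j)); exact: closeU.
have [x xt Ex] := mean_value_around dg; rewrite t_norm in xt.
have dl (s : R) : `|s| <= `|t| -> derivable (fun q => 'D_(e_ i) h q) (s *: e_ j + (x *: e_ i + p)) (e_ j).
  by rewrite t_norm => st; apply/ddh/closeU.
have [z zt Ez] := mean_value_line dl; rewrite t_norm in zt.
exists (z *: e_ j + (x *: e_ i + p)).
  exact: close.
rewrite -Ez (addrCA (t *: e_ j) (x *: e_ i)) -Ex.
by rewrite /g /square_increment !scale0r !add0r; ring.
Qed.

Lemma mixed_derive_sym U (h : 'rV[R]_2 -> R) p i j : open U -> U p ->
  (forall k q, U q -> derivable h q (e_ k)) ->
  (forall k l q, U q -> derivable (fun x => 'D_(e_ k) h x) q (e_ l)) ->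
  (forall k l, {for p, continuous (fun q => 'D_(e_ l) (fun x => 'D_(e_ k) h x) q)}) ->
  'D_(e_ j) (fun x => 'D_(e_ i) h x) p = 'D_(e_ i) (fun x => 'D_(e_ j) h x) p.
Proof.
move=> oU Up dh ddh cdh; have [->//|ij] := eqVneq i j.
apply/eqP; rewrite -subr_eq0 -normr_le0; apply/ler_addgt0Pr => e e0; rewrite add0r.
have e20 : 0 < e / 2 by rewrite divr_gt0.
have near_kl k l : \forall q \near p, U q /\
   `|'D_(e_ l) (fun x => 'D_(e_ k) h x) p - 'D_(e_ l) (fun x => 'D_(e_ k) h x) q| <= e / 2.
  near=> q; split; first by near: q; exact: open_nbhs_nbhs.
  near: q; move: (cdh k l) => /cvgrPdist_le; exact.
have [r r0 rP] := nbhs_rV2P (filterI (near_kl i j) (near_kl j i)).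
have rU q : (forall k, `|q 0 k - p 0 k| < r) -> U q by move=> /rP[[]].
have t0 : 0 < r / 2 by rewrite divr_gt0.
have tr : r / 2 < r by rewrite ltr_pdivrMr// ltr_pMr// ltr1n.
have [q1 q1r E1] := square_mixed_derive t0 tr ij rU (dh i) (ddh i j).
have ji : j != i by rewrite eq_sym.
have [q2 q2r E2] := square_mixed_derive t0 tr ji rU (dh j) (ddh j i).
have B1 := (rP q1 (fun k => le_lt_trans (q1r k) tr)).1.2.
have B2 := (rP q2 (fun k => le_lt_trans (q2r k) tr)).2.2.
have E : 'D_(e_ j) (fun x => 'D_(e_ i) h x) q1 = 'D_(e_ i) (fun x => 'D_(e_ j) h x) q2.
  have tn : r / 2 != 0 by rewrite gt_eqF.
  by apply/esym; move: E1; rewrite square_incrementC E2 => /(mulfI tn)/(mulfI tn).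
rewrite -E in B2.
exact: dist_split B1 B2.
Unshelve. all: by end_near. Qed.

End plane_calculus.

(** * Calculus of C^n functions on an open set *)

Section Cn_calculus.
Context {R : realType} {U : set 'rV[R]_2} (U_open : open U).
Implicit Types (p q d : 'rV[R]_2) (f g h : 'rV[R]_2 -> R).

Local Notation e_ i := (delta_mx 0 i : 'rV[R]_2).

Lemma near_open p (P : 'rV[R]_2 -> Prop) : U p -> (forall q, U q -> P q) ->
  \forall q \near p, P q.
Proof.
move=> Up UP; near=> q; apply: UP; near: q.
exact: open_nbhs_nbhs.
Unshelve. all: by end_near. Qed.

Lemma eq_on_derive {V : normedModType R} (h k : 'rV[R]_2 -> V) p d :
  U p -> (forall q, U q -> h q = k q) -> 'D_d h p = 'D_d k p.
Proof. by move=> Up hk; apply: near_eq_derive; apply: near_open. Qed.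

Lemma Cn_ext {V : normedModType R} n (h k : 'rV[R]_2 -> V) :
  (forall p, U p -> h p = k p) -> Cn n U h -> Cn n U k.
Proof.
elim: n h k => [|n IH] h k hk /=.
  move=> ch p Up; suff : k q @[q --> p] --> k p by [].
  rewrite -(hk p Up); apply: cvg_trans (ch p Up).
  exact: (@near_eq_cvg _ _ (nbhs p) _ _ _ (near_open Up hk)).
move=> ch i; have [dh cdh] := ch i; split.
  move=> p Up; apply: near_eq_derivable (dh p Up).
  exact: near_open.
by apply: IH cdh => p Up; exact: eq_on_derive.
Qed.

Lemma Cn_step {V : normedModType R} n (h : 'rV[R]_2 -> V) (D : 'I_2 -> 'rV[R]_2 -> V) :
  (forall i p, U p -> is_derive p (e_ i) h (D i p)) ->
  (forall i, Cn n U (D i)) -> Cn n.+1 U h.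
Proof.
move=> dh cD i; split=> [p Up|]; first by have [] := dh i p Up.
by apply: Cn_ext (cD i) => p Up; have [_ ->] := dh i p Up.
Qed.

Lemma Cn_derive {V : normedModType R} n (h : 'rV[R]_2 -> V) i :
  Cn n.+1 U h -> Cn n U (fun p => 'D_(e_ i) h p).
Proof. by move=> /(_ i)[]. Qed.

Lemma Cn_is_derive {V : normedModType R} n (h : 'rV[R]_2 -> V) i p :
  Cn n.+1 U h -> U p -> is_derive p (e_ i) h ('D_(e_ i) h p).
Proof. by move=> /(_ i)[dh _] Up; apply: derivableP; exact: dh. Qed.

Lemma Cn1_differentiable h p : Cn 1 U h -> U p -> differentiable h p.
Proof.
move=> ch Up; apply: (C1_differentiable U_open Up) => i.
  by move=> q Uq; have [dh _] := ch i; exact: dh.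
by have [_ cdh] := ch i; exact: cdh.
Qed.

(** The case n = 0 is not formal: continuous partial derivatives must give
    continuity, through differentiability. *)
Lemma CnW n h : Cn n.+1 U h -> Cn n U h.
Proof.
elim: n h => [|n IH] h ch.
  by move=> p Up; apply: differentiable_continuous; exact: Cn1_differentiable.
apply: Cn_step => [i p Up|i]; first exact: Cn_is_derive ch Up.
by apply: IH; exact: Cn_derive.
Qed.

Lemma Cn_cst {V : normedModType R} n (c : V) : Cn n U (cst c).
Proof.
elim: n c => [|n IH] c; first by move=> p _; exact: cst_continuous.
by apply: (@Cn_step _ _ _ (fun _ => cst 0)) => // i p _; exact: is_derive_cst.
Qed.

Lemma CnD n f g : Cn n U f -> Cn n U g -> Cn n U (fun p => f p + g p).
Proof.
elim: n f g => [|n IH] f g cf cg.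
  by move=> p Up; apply: continuousD; [exact: cf|exact: cg].
apply: (@Cn_step _ _ _ (fun i p => 'D_(e_ i) f p + 'D_(e_ i) g p)) => [i p Up|i].
  exact: is_deriveD (Cn_is_derive i cf Up) (Cn_is_derive i cg Up).
by apply: IH; exact: Cn_derive.
Qed.

Lemma CnM n f g : Cn n U f -> Cn n U g -> Cn n U (fun p => f p * g p).
Proof.
elim: n f g => [|n IH] f g cf cg.
  by move=> p Up; apply: continuousM; [exact: cf|exact: cg].
apply: (@Cn_step _ _ _
    (fun i p => 'D_(e_ i) f p * g p + f p * 'D_(e_ i) g p)) => [i p Up|i].
  have := is_deriveM (Cn_is_derive i cf Up) (Cn_is_derive i cg Up).
  by move/is_derive_eq; apply; rewrite /GRing.scale /= addrC mulrC.
by apply: CnD; apply: IH; (exact: Cn_derive || exact: CnW).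
Qed.

Lemma CnN n f : Cn n U f -> Cn n U (fun p => - f p).
Proof.
move=> cf; apply: (@Cn_ext _ _ (fun p => -1 * f p)) => [p _|].
  by rewrite mulN1r.
by apply: CnM => //; exact: Cn_cst.
Qed.

Lemma CnB n f g : Cn n U f -> Cn n U g -> Cn n U (fun p => f p - g p).
Proof. by move=> cf cg; apply: CnD => //; exact: CnN. Qed.

Lemma Cn_sum n m (F : 'I_m -> 'rV[R]_2 -> R) :
  (forall k, Cn n U (F k)) -> Cn n U (fun p => \sum_k F k p).
Proof.
elim: m F => [|m IH] F cF.
  by apply: (Cn_ext _ (Cn_cst n 0)) => p _; rewrite big_ord0.
apply: (@Cn_ext _ _ (fun p => F ord0 p + \sum_k F (lift ord0 k) p)) => [p _|].
  by rewrite big_ord_recl.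
by apply: CnD => //; exact: IH.
Qed.

Lemma Cn_rowP n m (h : 'rV[R]_2 -> 'rV[R]_m) :
  Cn n U h <-> forall k, Cn n U (fun p => h p 0 k).
Proof.
elim: n h => [|n IH] h.
  split=> [ch k p Up|ch p Up].
    apply: (@continuous_comp _ _ _ h (fun x : 'rV[R]_m => x 0 k)).
      exact: ch.
    exact: coord_continuous.
  apply/(@cvgrPdist_le _ _ _ (nbhs p) _ h (h p)) => e e0; near=> q.
  rewrite [leLHS]/Num.Def.normr /= mx_normrE (bigmax_le _ (ltW e0))//= => -[i k] _.
  rewrite !mxE /= ord1; move: k; near: q; apply: filter_forall => /= k.
  by have /cvgrPdist_le := ch k p Up; exact.
split=> [ch k|ch].
  apply: (@Cn_step _ _ _ (fun i p => 'D_(e_ i) h p 0 k)) => [i p Up|i].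
    by have /is_derive_mxP := Cn_is_derive i ch Up; exact.
  by have /IH := Cn_derive i ch; exact.
apply: (@Cn_step _ _ _ (fun i p => \row_k 'D_(e_ i) (fun q => h q 0 k) p)).
  move=> i p Up; apply/is_derive_mxP => j k; rewrite mxE ord1.
  exact: Cn_is_derive (ch k) Up.
move=> i; apply/IH => k.
by apply: (Cn_ext _ (Cn_derive i (ch k))) => p _; rewrite mxE.
Unshelve. all: by end_near. Qed.

Lemma Cn_derive_any n h p d : Cn n.+1 U h -> U p ->
  is_derive p d h (d 0 0 * 'D_(e_ 0) h p + d 0 1 * 'D_(e_ 1) h p).
Proof.
move=> ch Up; have dh : differentiable h p.
  apply: Cn1_differentiable Up; elim: n ch => // n IH ch; apply: IH.
  exact: CnW.
apply: DeriveDef; first exact: diff_derivable.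
exact: differentiable_derive2.
Qed.

Lemma Cn_derive_sym h p i j : Cn 2 U h -> U p ->
  'D_(e_ j) (fun q => 'D_(e_ i) h q) p = 'D_(e_ i) (fun q => 'D_(e_ j) h q) p.
Proof.
move=> ch Up; apply: (@mixed_derive_sym R U h p i j U_open Up).
- by move=> k q Uq; have [dh _] := ch k; exact: dh.
- by move=> k l q Uq; have [_ /(_ l)[dh _]] := ch k; exact: dh.
- by move=> k l; have [_ /(_ l)[_ cdh]] := ch k; exact: cdh.
Qed.

End Cn_calculus.

Section coordinate_functions.
Context {R : realType}.

Lemma is_derive_coord (b : R -> R) (i : 'I_2) (p d : 'rV[R]_2) b' :
  is_derive (p 0 i) 1 b b' ->
  is_derive p d (fun q : 'rV[R]_2 => b (q 0 i)) (d 0 i * b').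
Proof.
move=> [/derivable1_diffP db bE].
have E : (fun k : R => k^-1 *: (((fun q : 'rV[R]_2 => b (q 0 i)) \o shift p) (k *: d)
    - b (p 0 i))) =
  (fun k => k^-1 *: ((b \o shift (p 0 i)) (k *: d 0 i) - b (p 0 i))).
  by apply/funext => k /=; rewrite !mxE.
split; rewrite /derivable /derive E.
  exact: diff_derivable.
rewrite -[LHS]/('D_(d 0 i) b (p 0 i)) deriveE// -[d 0 i in LHS]mulr1.
by rewrite -[_ * 1]/(_ *: 1) linearZ /= -deriveE// bE.
Qed.

Lemma open_strip (I : set R) : open I -> open (strip I).
Proof.
move=> I_open; rewrite /strip; apply: (@open_comp _ _ (fun p : 'rV[R]_2 => p 0 0)) => //.
by move=> p _; exact: coord_continuous.
Qed.

End coordinate_functions.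

(** * Structure equations *)

Section structure_equations.
Context {R : realType}.

Definition mx5 (l : seq (seq R)) : 'M[R]_5 :=
  \matrix_(i, j) nth 0 (nth [::] l i) j.

(** The moving frame equations of the surface to be found are dF = (M ds + W dt) F
    for the matrix F with rows phi, E1, E2, E3, E4; these are M, with k the
    principal curvature k_1, and W, where r = sqrt g22 converts E2 into d/dt. *)
Definition conn_s (eps k x v : R) : 'M[R]_5 :=
  mx5 [:: [:: 0; 1; 0; 0; 0];
          [:: - eps; 0; 0; k; x];
          [:: 0; 0; 0; 0; 0];
          [:: 0; - k; 0; 0; v];
          [:: 0; - x; 0; - v; 0]].

Definition conn_t (eps r u x y : R) : 'M[R]_5 :=
  mx5 [:: [:: 0; 0; r; 0; 0];
          [:: 0; 0; - (r * u); 0; 0];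
          [:: - (eps * r); r * u; 0; r * y; - (r * x)];
          [:: 0; 0; - (r * y); 0; 0];
          [:: 0; 0; r * x; 0; 0]].

(** The form D for which F^T D F is constant. When eps <> 0, its inverse is the
    Gram matrix of the rows of an adapted frame; D keeps a meaning at eps = 0. *)
Definition gram_dual (eps : R) : 'M[R]_5 :=
  mx5 [:: [:: eps; 0; 0; 0; 0];
          [:: 0; 1; 0; 0; 0];
          [:: 0; 0; 1; 0; 0];
          [:: 0; 0; 0; 1; 0];
          [:: 0; 0; 0; 0; 1]].

Local Notation o k := (@Ordinal 5 k isT).

Lemma forall_ord5 (P : 'I_5 -> Prop) :
  P (o 0) -> P (o 1) -> P (o 2) -> P (o 3) -> P (o 4) -> forall i, P i.
Proof.
by move=> P0 P1 P2 P3 P4 [[|[|[|[|[|//]]]]] k]; rewrite (bool_irrelevance k isT).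
Qed.

Lemma sum5 (V : nmodType) (f : 'I_5 -> V) :
  \sum_i f i = f (o 0) + f (o 1) + f (o 2) + f (o 3) + f (o 4).
Proof.
rewrite !big_ord_recr big_ord0 /= add0r.
by do !congr (_ + _); congr f; apply/val_inj.
Qed.

Lemma conn_s_skew eps k x v :
  (conn_s eps k x v)^T *m gram_dual eps + gram_dual eps *m conn_s eps k x v = 0.
Proof.
apply/matrixP; elim/forall_ord5; elim/forall_ord5;
  rewrite !mxE !sum5 !mxE /=; ring.
Qed.

Lemma conn_t_skew eps r u x y :
  (conn_t eps r u x y)^T *m gram_dual eps
  + gram_dual eps *m conn_t eps r u x y = 0.
Proof.
apply/matrixP; elim/forall_ord5; elim/forall_ord5;
  rewrite !mxE !sum5 !mxE /=; ring.
Qed.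

(** The Gauss, Codazzi and Ricci equations of the frame are the vanishing of
    the curvature of the connection given by the two matrices; they amount to
    the equations for u, x and y. *)
Lemma conn_t_compatible (eps : R) (r u w x y v : R -> R) (s : R) :
  is_derive s 1 r (- (u s * r s)) ->
  is_derive s 1 u (eps + y s * (2 * w s - y s) - x s ^+ 2 + u s ^+ 2) ->
  is_derive s 1 x (2 * x s * u s + y s * v s) ->
  is_derive s 1 y (2 * u s * (y s - w s) - x s * v s) ->
  let M := conn_s eps (2 * w s - y s) (x s) (v s) in
  is_derive s 1 (fun s => conn_t eps (r s) (u s) (x s) (y s))
    (M *m conn_t eps (r s) (u s) (x s) (y s)
     - conn_t eps (r s) (u s) (x s) (y s) *m M).
Proof.
move=> dr du dx dy M; apply/is_derive_mxP.
have dru := is_deriveM dr du; have drx := is_deriveM dr dx.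
have dry := is_deriveM dr dy; have der := is_deriveZ eps dr.
have dru' := is_deriveN dru; have drx' := is_deriveN drx.
have dry' := is_deriveN dry; have der' := is_deriveN der.
have d0 := is_derive_cst (0 : R) s (1 : R).
elim/forall_ord5; elim/forall_ord5; (under eq_fun do rewrite mxE /=);
  (apply: (is_derive_eq d0) || apply: (is_derive_eq dr) ||
   apply: (is_derive_eq der') || apply: (is_derive_eq dru') ||
   apply: (is_derive_eq dru) || apply: (is_derive_eq dry) ||
   apply: (is_derive_eq drx') || apply: (is_derive_eq dry') ||
   apply: (is_derive_eq drx)); rewrite !mxE !sum5 !mxE /=; rewrite /GRing.scale /=;
   ring.
Qed.

End structure_equations.

(** * Smoothness of the solutions *)

Section coordinate_smoothness.
Context {R : realType} {I : set R} (I_open : open I).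
Local Notation U := (strip I).
Local Notation lift f := (fun p : 'rV[R]_2 => f (p 0 0)).
Let U_open : open U := open_strip I_open.

Lemma Cn0_coord (b : R -> R) (i : 'I_2) :
  (forall p, U p -> {for p 0 i, continuous b}) -> Cn 0 U (fun p => b (p 0 i)).
Proof.
move=> cb p Up; apply: (@continuous_comp _ _ _ (fun q : 'rV[R]_2 => q 0 i) b).
  exact: coord_continuous.
exact: cb.
Qed.

Lemma Cn_coord_step n (b b' : R -> R) (i : 'I_2) :
  (forall p, U p -> is_derive (p 0 i) 1 b (b' (p 0 i))) ->
  Cn n U (fun p => b' (p 0 i)) -> Cn n.+1 U (fun p => b (p 0 i)).
Proof.
move=> db cb'.
apply: (@Cn_step _ _ U_open _ _ _
  (fun j p => (delta_mx 0 j : 'rV[R]_2) 0 i * b' (p 0 i))) => [j p Up|j].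
  by apply: is_derive_coord; exact: db.
by apply: CnM => //; exact: Cn_cst.
Qed.

Lemma Cn_mulmx n k (A B : 'rV[R]_2 -> 'M[R]_k) :
  (forall i j, Cn n U (fun p => A p i j)) ->
  (forall i j, Cn n U (fun p => B p i j)) ->
  forall i j, Cn n U (fun p => (A p *m B p) i j).
Proof.
move=> cA cB i j.
apply: (@Cn_ext _ _ U_open _ _ (fun p => \sum_k A p i k * B p k j)).
  by move=> p _; rewrite mxE.
by apply: Cn_sum => // l; apply: CnM.
Qed.

Lemma is_derive_inv (f : R -> R) (s df : R) : f s != 0 -> is_derive s 1 f df ->
  is_derive s 1 (fun s => (f s)^-1) (- (f s)^-1 ^+ 2 * df).
Proof.
move=> fs [dfs <-]; apply: DeriveDef; first exact: derivableV.
by rewrite deriveV// exprVn.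
Qed.

(** Smoothness of the solutions is a bootstrap: the derivative of each of the
    functions u, w, x, y and 1 / (3w - y) is a polynomial in them and in the
    derivatives of v. *)
Lemma ode_solution_smooth (eps : R) (v u w x y : R -> R)
  (v_smooth : smooth1 I v)
  (wy_neq0 : forall s, I s -> 3 * w s - y s != 0)
  (ode_u : forall s, I s ->
     is_derive s 1 u (eps + y s * (2 * w s - y s) - x s ^+ 2 + u s ^+ 2))
  (ode_w : forall s, I s ->
     is_derive s 1 w (- (w s * x s * v s / (3 * w s - y s))))
  (ode_x : forall s, I s -> is_derive s 1 x (2 * x s * u s + y s * v s))
  (ode_y : forall s, I s ->
     is_derive s 1 y (2 * u s * (y s - w s) - x s * v s)) :
  forall n, [/\ Cn n U (lift u), Cn n U (lift w), Cn n U (lift x),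
    Cn n U (lift y) & forall k, Cn n U (lift (v^`(k)))].
Proof.
pose z s := (3 * w s - y s)^-1.
pose dw s := - (w s * x s * v s * z s).
pose dy s := 2 * u s * (y s - w s) - x s * v s.
have dz s : I s -> is_derive s 1 z (- (3 * dw s - dy s) * z s * z s).
  move=> Is; have wy := wy_neq0 _ Is.
  have dd : is_derive s 1 (fun s => 3 * w s - y s) (3 * dw s - dy s).
    by apply: is_deriveB; [apply: is_deriveZ; exact: ode_w|exact: ode_y].
  have di := @is_derive_inv (fun s => 3 * w s - y s) s _ wy dd.
  have E : - (3 * w s - y s)^-1 ^+ 2 * (3 * dw s - dy s) =
    - (3 * dw s - dy s) * z s * z s by rewrite -/(z s); ring.
  by rewrite -E; exact: di.
have dv k s : I s -> is_derive s 1 (v^`(k)) (v^`(k.+1) s).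
  move=> Is; rewrite derive1nS derive1E; apply: derivableP; exact: v_smooth.
have d2c (f : R -> R) (df : R -> R) : (forall s, I s -> is_derive s 1 f (df s)) ->
    Cn 0 U (lift f).
  move=> dF; apply: Cn0_coord => p Up; exact: is_derive_continuous (dF _ Up).
have step n (f df : R -> R) : (forall s, I s -> is_derive s 1 f (df s)) ->
    Cn n U (lift df) -> Cn n.+1 U (lift f).
  by move=> dF; apply: Cn_coord_step => p; exact: dF.
suff H n : [/\ Cn n U (lift u), Cn n U (lift w), Cn n U (lift x),
    Cn n U (lift y) & Cn n U (lift z) /\ forall k, Cn n U (lift (v^`(k)))].
  by move=> n; have [? ? ? ? []] := H n.
elim: n => [|n [cu cw cx cy [cz cv]]].
  split; [exact: d2c ode_u|exact: d2c ode_w|exact: d2c ode_x|exact: d2c ode_y|].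
  by split=> [|k]; [exact: d2c dz|exact: d2c (dv k)].
have cv0 : Cn n U (lift v) := cv 0%N.
have c2 (c : R) : Cn n U (fun _ => c) by exact: Cn_cst.
have cdw : Cn n U (lift dw) by apply: CnN => //; do !apply: CnM => //.
have cdy : Cn n U (lift dy).
  by apply: CnB => //; do !apply: CnM => //; apply: CnB.
split; [apply: step ode_u _|apply: step ode_w _|apply: step ode_x _|
        apply: step ode_y _|split=> [|k]; [apply: step dz _|exact: step (dv k) _]].
- apply: CnD => //; last by apply: (@CnM _ _ U_open _ _ _ cu cu).
  apply: CnB => //; last by apply: (@CnM _ _ U_open _ _ _ cx cx).
  by apply: CnD => //; apply: CnM => //; apply: CnB => //; apply: CnM.
- exact: cdw.
- by apply: CnD => //; do !apply: CnM => //.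
- exact: cdy.
- apply: CnM => //; apply: CnM => //; apply: CnN => //; apply: CnB => //.
  exact: CnM.
Qed.

End coordinate_smoothness.

(** * The moving frame *)

Lemma derive0_constant_mx (R : realType) m n (I : set R) (Y : R -> 'M[R]_(m, n)) :
  is_interval I -> (forall s, I s -> is_derive s 1 Y 0) ->
  forall s s', I s -> I s' -> Y s = Y s'.
Proof.
move=> I_itv dY s s' Is Is'; apply/matrixP => i j.
apply: (@derive0_constant _ I (fun s => Y s i j)) => // z Iz.
by have /is_derive_mxP/(_ i j) := dY z Iz; rewrite mxE.
Qed.

(** The derivative of Y^T D Y is Y^T (A^T D + D A) Y. *)
Lemma skew_flow_conserved (R : realType) n (I : set R) (A Y : R -> 'M[R]_n)
    (D : 'M[R]_n) : is_interval I ->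
  (forall s, I s -> (A s)^T *m D + D *m A s = 0) ->
  (forall s, I s -> is_derive s 1 Y (A s *m Y s)) ->
  forall s s', I s -> I s' ->
  (Y s)^T *m D *m Y s = (Y s')^T *m D *m Y s'.
Proof.
move=> I_itv AD dY; apply: derive0_constant_mx => // s Is.
have dT := is_derive_trmx (dY s Is).
have d := is_derive_mulmx (is_derive_mulmx dT (is_derive_cst D s 1)) (dY s Is).
apply: (is_derive_eq d); rewrite mulmx0 addr0 trmx_mul -!mulmxA -mulmxDr.
by rewrite !mulmxA -mulmxDl AD // mul0mx mulmx0.
Qed.

Section moving_frame.
Context {R : realType} (eps : R) (I : set R) (v u w x y r : R -> R)
  (I_open : open I) (I_itv : is_interval I) (s0 : R) (Is0 : I s0)
  (v_smooth : smooth1 I v)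
  (wy_neq0 : forall s, I s -> 3 * w s - y s != 0)
  (ode_u : forall s, I s ->
     is_derive s 1 u (eps + y s * (2 * w s - y s) - x s ^+ 2 + u s ^+ 2))
  (ode_w : forall s, I s ->
     is_derive s 1 w (- (w s * x s * v s / (3 * w s - y s))))
  (ode_x : forall s, I s -> is_derive s 1 x (2 * x s * u s + y s * v s))
  (ode_y : forall s, I s ->
     is_derive s 1 y (2 * u s * (y s - w s) - x s * v s))
  (ode_r : forall s, I s -> is_derive s 1 r (- (u s * r s))).

Local Notation U := (strip I).
Let M s := conn_s eps (2 * w s - y s) (x s) (v s).
Let W s := conn_t eps (r s) (u s) (x s) (y s).
Let D := gram_dual eps.

Let M_continuous : continuous_mx_on (I := I) M.
Proof.
move=> s i j Is; have c0 := @cst_continuous R R (0 : R) s.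
have c1 := @cst_continuous R R (1 : R) s.
have ce := @cst_continuous R R (- eps : R) s.
have cw := is_derive_continuous (ode_w Is).
have cx := is_derive_continuous (ode_x Is).
have cy := is_derive_continuous (ode_y Is).
have cv : {for s, continuous v}.
  apply: differentiable_continuous; apply/derivable1_diffP.
  exact: (v_smooth (n := 0) Is).
have ck : {for s, continuous (fun s => 2 * w s - y s)}.
  apply: (@continuousD _ _ _ (fun s => 2 * w s) (- y)); last exact: continuousN.
  by apply: (@continuousM _ _ (cst 2) w) => //; exact: cst_continuous.
have ckN := continuousN ck; have cxN := continuousN cx.
have cvN := continuousN cv.
move: i j; elim/forall_ord5; elim/forall_ord5;
  (rewrite /M; under [X in {for _, continuous X}]eq_fun do rewrite mxE /=);
  (exact: c0 || exact: c1 || exact: ce || exact: ck || exact: cx || exact: cv ||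
   exact: ckN || exact: cxN || exact: cvN).
Qed.

Let W_derive s : I s -> is_derive s 1 W (M s *m W s - W s *m M s).
Proof.
move=> Is.
exact: (conn_t_compatible (ode_r Is) (ode_u Is) (ode_x Is) (ode_y Is)).
Qed.

(** F is the frame along t = 0, and T is the one-parameter group generated by
    F^-1 W F, which does not depend on s because of W' = M W - W M. The inverse
    of F is the transpose of a solution of Z' = - M^T Z. *)
Lemma frame_factors : exists (F T : R -> 'M[R]_5) (C : 'M[R]_5),
  [/\ F s0 = 1%:M /\ T 0 = 1%:M,
      forall s, I s -> is_derive s 1 F (M s *m F s),
      forall t : R, is_derive t 1 T (C *m T t) &
      forall s, I s -> F s *m C = W s *m F s].
Proof.
have [F [F0 dF]] := linear_ode_solution I_open I_itv (1%:M : 'M[R]_5) Is0 M_continuous.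
have MT_continuous : continuous_mx_on (I := I) (fun s => - (M s)^T).
  move=> s i j Is.
  rewrite (_ : (fun s => _) = - (fun s => M s j i)).
    by apply: continuousN; exact: M_continuous.
  by apply/funext => z; rewrite mxE [X in - X]mxE.
have [Z [Z0 dZ]] := linear_ode_solution I_open I_itv (1%:M : 'M[R]_5) Is0 MT_continuous.
pose G s := (Z s)^T.
have dG s : I s -> is_derive s 1 G (- (G s *m M s)).
  move=> Is; have := is_derive_trmx (dZ s Is).
  by rewrite mulNmx linearN /= trmx_mul trmxK.
have GF s : I s -> G s *m F s = 1%:M.
  move=> Is; rewrite (derive0_constant_mx (Y := fun s => G s *m F s) I_itv _ Is Is0).
    by rewrite /G Z0 F0 trmx1 mulmx1.
  move=> z Iz; apply: (is_derive_eq (is_derive_mulmx (dG z Iz) (dF z Iz))).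
  by rewrite mulNmx mulmxA addNr.
pose C := G s0 *m W s0 *m F s0.
have CE s : I s -> G s *m W s *m F s = C.
  move=> Is; rewrite (derive0_constant_mx (Y := fun s => G s *m W s *m F s) I_itv _ Is Is0) // => z Iz.
  have d := is_derive_mulmx (is_derive_mulmx (dG z Iz) (W_derive Iz)) (dF z Iz).
  apply: (is_derive_eq d).
  rewrite mulNmx mulmxBr !mulmxA addrA addNr add0r mulNmx -!mulmxA; exact: addNr.
have C_continuous : continuous_mx_on (I := [set: R]) (fun _ => C).
  by move=> s i j _; exact: cst_continuous.
have [T [T0 dT]] := linear_ode_solution openT (fun _ _ _ _ _ _ => Logic.I)
  (1%:M : 'M[R]_5) (Logic.I : [set: R] 0) C_continuous.
exists F, T, C; split=> // [t|s Is]; first exact: dT.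
by rewrite -(CE _ Is) !mulmxA (mulmx1C (GF _ Is)) mul1mx.
Qed.

(** The frame is F(s) T(t). Its t-derivative is W F T because F C = W F. *)
Lemma moving_frame : exists Phi : 'rV[R]_2 -> 'M[R]_5,
  [/\ forall p d, U p ->
        is_derive p d Phi ((d 0 0 *: M (p 0 0) + d 0 1 *: W (p 0 0)) *m Phi p),
      forall p, U p -> (Phi p)^T *m D *m Phi p = D,
      exists2 p, U p & Phi p = 1%:M &
      forall n i j, Cn n U (fun p => Phi p i j)].
Proof.
have [F [T [C [[F0 T0] dF dT FC]]]] := frame_factors.
pose Phi (p : 'rV[R]_2) := F (p 0 0) *m T (p 0 1).
have dPhi p d : U p ->
    is_derive p d Phi ((d 0 0 *: M (p 0 0) + d 0 1 *: W (p 0 0)) *m Phi p).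
  move=> Up.
  have dFp : is_derive p d (fun p : 'rV[R]_2 => F (p 0 0)) (d 0 0 *: (M (p 0 0) *m F (p 0 0))).
    apply/is_derive_mxP => i j; rewrite mxE.
    apply: (@is_derive_coord _ (fun s => F s i j)).
    by have /is_derive_mxP := dF _ Up; exact.
  have dTp : is_derive p d (fun p : 'rV[R]_2 => T (p 0 1)) (d 0 1 *: (C *m T (p 0 1))).
    apply/is_derive_mxP => i j; rewrite mxE.
    apply: (@is_derive_coord _ (fun s => T s i j)).
    by have /is_derive_mxP := dT (p 0 1); exact.
  apply: (is_derive_eq (is_derive_mulmx dFp dTp)).
  rewrite -scalemxAr mulmxA FC// mulmxDl -!scalemxAl -!mulmxA.
  by [].
exists Phi; split=> //.
- move=> p Up.
  have T_itv : is_interval [set: R] by [].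
  rewrite (@skew_flow_conserved _ _ [set: R] (fun _ => W (p 0 0))
    (fun t => F (p 0 0) *m T t) D T_itv _ _ (p 0 1) 0) //.
  + rewrite T0 mulmx1 (@skew_flow_conserved _ _ I M F D I_itv _ dF _ s0) //.
      by rewrite F0 trmx1 mul1mx mulmx1.
    by move=> s Is; exact: conn_s_skew.
  + by move=> t _; exact: conn_t_skew.
  + move=> t _.
    apply: (is_derive_eq (is_derive_mulmx (is_derive_cst (F (p 0 0)) t 1) (dT t))).
    by rewrite mul0mx add0r mulmxA FC // mulmxA.
- exists (\row_i if i == 0 then s0 else 0); rewrite /strip /= ?mxE //.
  by rewrite /Phi !mxE /= F0 T0 mulmx1.
- have sm n := ode_solution_smooth I_open v_smooth wy_neq0 ode_u ode_w ode_x ode_y n.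
  have UO := open_strip I_open.
  have cM n i j : Cn n U (fun p => M (p 0 0) i j).
    have [cu cw cx cy /(_ 0%N) cv] := sm n.
    have c0 (c : R) : Cn n U (fun _ => c) by exact: Cn_cst.
    have ck : Cn n U (fun p => 2 * w (p 0 0) - y (p 0 0)).
      by apply: CnB => //; exact: CnM.
    have ckN := CnN UO ck; have cxN := CnN UO cx; have cvN := CnN UO cv.
    move: i j; elim/forall_ord5; elim/forall_ord5;
      (rewrite /M; under [X in Cn _ _ X]eq_fun do rewrite mxE /=);
      (exact: c0 || exact: ck || exact: cx || exact: cv ||
       exact: ckN || exact: cxN || exact: cvN).
  have dFij i j p : U p ->
      is_derive (p 0 0) 1 (fun s => F s i j) ((M (p 0 0) *m F (p 0 0)) i j).
    by move=> Up; have /is_derive_mxP := dF _ Up; exact.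
  have dTij i j (t : R) : is_derive t 1 (fun s => T s i j) ((C *m T t) i j).
    by have /is_derive_mxP := dT t; exact.
  suff H n : (forall i j, Cn n U (fun p => F (p 0 0) i j)) /\
             (forall i j, Cn n U (fun p => T (p 0 1) i j)).
    by move=> n; have [? ?] := H n; apply: Cn_mulmx.
  elim: n => [|n [cF cT]].
    split=> i j.
      apply: (Cn0_coord (b := fun s => F s i j)) => p Up.
      exact: is_derive_continuous (dFij i j p Up).
    apply: (Cn0_coord (b := fun s => T s i j)) => p Up.
    exact: is_derive_continuous (dTij i j _).
  split=> i j.
    apply: (@Cn_coord_step _ _ I_open n (fun s => F s i j)
      (fun s => (M s *m F s) i j) 0 (dFij i j)).
    by apply: Cn_mulmx.
  apply: (@Cn_coord_step _ _ I_open n (fun s => T s i j)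
    (fun s => (C *m T s) i j) 1 (fun p _ => dTij i j (p 0 1))).
  by apply: Cn_mulmx => // k l; exact: Cn_cst.
Qed.

End moving_frame.

(** * Scalar products of the frame *)

Section frame_gram.
Context {R : realType} (eps : R).
Local Notation o k := (@Ordinal 5 k isT).
Local Notation sg := (if eps < 0 then -1 else 1 : R).
Local Notation J := (gram_dual sg).
Local Notation D := (gram_dual eps).

Lemma gram_dual_mul (a b : R) : gram_dual a *m gram_dual b = gram_dual (a * b).
Proof.
apply/matrixP; elim/forall_ord5; elim/forall_ord5;
  rewrite !mxE !sum5 !mxE /= ?mulr0 ?mul0r ?mulr1 ?addr0 ?add0r //.
Qed.

Lemma gram_dual1 : gram_dual 1 = 1%:M :> 'M[R]_5.
Proof. by apply/matrixP; elim/forall_ord5; elim/forall_ord5; rewrite !mxE. Qed.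

Lemma tr_gram_dual (a : R) : (gram_dual a)^T = gram_dual a.
Proof. by apply/matrixP; elim/forall_ord5; elim/forall_ord5; rewrite !mxE. Qed.

Lemma dot5E (X Y : 'rV[R]_5) : dot5 eps X Y = (X *m J *m Y^T) 0 0.
Proof.
rewrite /dot5; move: (if _ then _ else _) => a.
rewrite !mxE !sum5 !mxE !sum5 !mxE /= !big_ord_recl big_ord0 addr0.
rewrite !mulr0 !mulr1 !addr0 !add0r.
rewrite (_ : lift ord0 ord0 = o 1); last exact: val_inj.
rewrite (_ : lift ord0 (lift ord0 ord0) = o 2); last exact: val_inj.
rewrite (_ : lift ord0 (lift ord0 (lift ord0 ord0)) = o 3); last exact: val_inj.
rewrite (_ : lift ord0 (lift ord0 (lift ord0 (lift ord0 ord0))) = o 4); last exact: val_inj.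
rewrite (_ : ord0 = o 0); last exact: val_inj.
by ring.
Qed.

Lemma dot5C (X Y : 'rV[R]_5) : dot5 eps X Y = dot5 eps Y X.
Proof.
by rewrite /dot5 [X 0 ord0 * _]mulrC; congr (_ + _); apply: eq_bigr => i _; rewrite mulrC.
Qed.

Lemma dot5_rows (F : 'M[R]_5) i j :
  dot5 eps (row i F) (row j F) = (F *m J *m F^T) i j.
Proof. by rewrite dot5E tr_row -!row_mul !mxE; apply: eq_bigr => k _; rewrite !mxE. Qed.

(** If eps <> 0, inverting F^T D F = J gives F J F^T = D^-1, whose entries are
    the scalar products of the rows. If eps = 0, D is degenerate; replacing the
    first row of F by the first basis vector gives an orthogonal matrix B. *)
Lemma frame_gram (F : 'M[R]_5) :
  F^T *m D *m F = gram_dual (Num.sg eps) ->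
  [/\ forall i j, i != o 0 -> j != o 0 ->
        dot5 eps (row i F) (row j F) = (i == j)%:R,
      eps != 0 -> dot5 eps (row (o 0) F) (row (o 0) F) = eps^-1,
      eps != 0 -> forall i, i != o 0 -> dot5 eps (row i F) (row (o 0) F) = 0,
      eps = 0 -> forall i, i != o 0 -> F i (o 0) = 0 &
      forall Z : 'rV[R]_5,
        (if eps == 0 then Z 0 (o 0) = 0 else dot5 eps Z (row (o 0) F) = 0) ->
        Z = \sum_(i | i != o 0) dot5 eps Z (row i F) *: row i F].
Proof.
move=> FDF; have [eps0|eps_neq0] := eqVneq eps 0.
- pose e0 : 'M[R]_5 := delta_mx (o 0) (o 0).
  have J1 : J = 1%:M by rewrite eps0 ltxx gram_dual1.
  have e0D : e0^T *m D = 0 /\ D *m e0 = 0.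
    split; apply/matrixP; elim/forall_ord5; elim/forall_ord5;
      by rewrite !mxE !sum5 !mxE /= ?eps0; ring.
  have e00 : gram_dual 0 + e0^T *m e0 = 1%:M.
    apply/matrixP; elim/forall_ord5; elim/forall_ord5;
      by rewrite !mxE !sum5 !mxE /=; ring.
  have DD : D *m D = D by rewrite gram_dual_mul eps0 mulr0.
  pose B := D *m F + e0.
  have BB : B^T *m B = 1%:M.
    have -> : B^T = F^T *m D + e0^T.
      by apply/matrixP => i j; rewrite -[in F^T *m D]tr_gram_dual -trmx_mul !mxE.
    rewrite /B mulmxDl !mulmxDr.
    rewrite !mulmxA (_ : F^T *m D *m D = F^T *m D) -?mulmxA ?DD//.
    rewrite mulmxA FDF (mulmxA _ D F) e0D.1 mul0mx e0D.2 mulmx0 addr0 add0r.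
    by rewrite eps0 sgr0 e00.
  have BBt : B *m B^T = 1%:M by exact: mulmx1C.
  have rowB i : i != o 0 -> row i B = row i F.
    move: i; elim/forall_ord5 => // _; apply/rowP;
      by move=> j; rewrite !mxE !sum5 !mxE /=; ring.
  have row0B : row (o 0) B = delta_mx 0 (o 0).
    by apply/rowP; elim/forall_ord5; rewrite !mxE !sum5 !mxE /= ?eps0; ring.
  have dotB i j : dot5 eps (row i B) (row j B) = (i == j)%:R.
    by rewrite dot5_rows J1 mulmx1 BBt mxE.
  have dot0 Z : dot5 eps Z (delta_mx 0 (o 0)) = Z 0 (o 0).
    by rewrite dot5E J1 mulmx1 trmx_delta !mxE sum5 !mxE /=; ring.
  split.
  + by move=> i j i0 j0; rewrite -!rowB// dotB.
  + by [].
  + by [].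
  + move=> _ i i0; have := dotB i (o 0).
    by rewrite row0B dot0 rowB// (negPf i0) mxE.
  + move=> Z Z0.
    rewrite -[LHS]mulmx1 -BB mulmxA mulmx_sum_row (bigD1 (o 0)) //=.
    have ZB i : (Z *m B^T) 0 i = dot5 eps Z (row i B).
      by rewrite dot5E J1 mulmx1 tr_row !mxE; apply: eq_bigr => k _; rewrite !mxE.
    rewrite ZB row0B dot0 Z0 scale0r add0r; apply: eq_bigr => i i0.
    by rewrite ZB rowB.
- have sgE : Num.sg eps = sg.
    by case: ltrgt0P eps_neq0 => // ?; [rewrite gtr0_sg|rewrite ltr0_sg].
  have JJ : J *m J = 1%:M.
    by rewrite gram_dual_mul; case: ifP => _; rewrite ?mulrNN mulr1 gram_dual1.
  have F1 : J *m F^T *m D *m F = 1%:M by rewrite -!mulmxA (mulmxA F^T) FDF sgE JJ.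
  have FJF : F *m J *m F^T = gram_dual eps^-1.
    have := mulmx1C F1; rewrite !mulmxA => FJFD.
    have DD1 : D *m gram_dual eps^-1 = 1%:M.
      by rewrite gram_dual_mul mulfV// gram_dual1.
    by rewrite -[LHS]mulmx1 -DD1 mulmxA FJFD mul1mx.
  have dotF i j : dot5 eps (row i F) (row j F) = gram_dual eps^-1 i j.
    by rewrite dot5_rows FJF.
  split.
  + by move=> i j; rewrite dotF; move: i j; elim/forall_ord5 => //; elim/forall_ord5 => //; rewrite mxE.
  + by move=> _; rewrite dotF mxE.
  + by move=> _ i; rewrite dotF; move: i; elim/forall_ord5; rewrite ?mxE.
  + by move=> e0; rewrite e0 eqxx in eps_neq0.
  + move=> Z Z0.
    rewrite -[LHS]mulmx1 -F1 !mulmxA mulmx_sum_row (bigD1 (o 0)) //=.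
    have ZF i : (Z *m J *m F^T) 0 i = dot5 eps Z (row i F).
      by rewrite dot5E tr_row !mxE; apply: eq_bigr => k _; rewrite !mxE.
    have ZFD i : (Z *m J *m F^T *m D) 0 i = dot5 eps Z (row i F) * D i i.
      rewrite -ZF; move: (Z *m J *m F^T) i => A; rewrite /gram_dual.
      by elim/forall_ord5; rewrite mxE sum5 !mxE /=; ring.
    rewrite ZFD Z0 mul0r scale0r add0r; apply: eq_bigr => i i0.
    rewrite ZFD; move: i i0; elim/forall_ord5 => // _; by rewrite mxE /= mulr1.
Qed.

End frame_gram.

(** * The adapted frame of the immersion *)

Section adapted_frame.
Context {R : realType}.
Local Notation o k := (@Ordinal 5 k isT).

(** All that the geometry needs to know about the frame. The trace of A3 is 2w,
    whence the principal curvature 2w - y along E1. In the derivative along [d],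
    the coefficient [d 0 1 * r] is the E2-component of [d]. *)
Record adapted_frame (eps : R) (I : set R) (v u w x y r : R -> R)
    (phi E1 E2 E3 E4 : 'rV[R]_2 -> 'rV[R]_5) : Prop := AdaptedFrame {
  frame_phi : forall p d, strip I p ->
    is_derive p d phi (d 0 0 *: E1 p + (d 0 1 * r (p 0 0)) *: E2 p);
  frame_E1 : forall p d, strip I p ->
    is_derive p d E1
      (d 0 0 *: ((2 * w (p 0 0) - y (p 0 0)) *: E3 p + x (p 0 0) *: E4 p
                 - eps *: phi p)
       - (d 0 1 * r (p 0 0) * u (p 0 0)) *: E2 p);
  frame_E2 : forall p d, strip I p ->
    is_derive p d E2
      ((d 0 1 * r (p 0 0)) *: (u (p 0 0) *: E1 p + y (p 0 0) *: E3 p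
         - x (p 0 0) *: E4 p - eps *: phi p));
  frame_E3 : forall p d, strip I p ->
    is_derive p d E3
      (d 0 0 *: (v (p 0 0) *: E4 p - (2 * w (p 0 0) - y (p 0 0)) *: E1 p)
       - (d 0 1 * r (p 0 0) * y (p 0 0)) *: E2 p);
  frame_E4 : forall p d, strip I p ->
    is_derive p d E4
      (- d 0 0 *: (x (p 0 0) *: E1 p + v (p 0 0) *: E3 p)
       + (d 0 1 * r (p 0 0) * x (p 0 0)) *: E2 p);
  frame_smooth : [/\ smooth (strip I) phi, smooth (strip I) E1,
    smooth (strip I) E2, smooth (strip I) E3 & smooth (strip I) E4];
  frame_space : forall p, strip I p -> space_form eps (phi p);
  frame_tangent : forall p, strip I p ->
    [/\ space_form_tangent eps (phi p) (E1 p),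
        space_form_tangent eps (phi p) (E2 p),
        space_form_tangent eps (phi p) (E3 p) &
        space_form_tangent eps (phi p) (E4 p)];
  frame_unit : forall p, strip I p ->
    [/\ dot5 eps (E1 p) (E1 p) = 1, dot5 eps (E2 p) (E2 p) = 1,
        dot5 eps (E3 p) (E3 p) = 1 & dot5 eps (E4 p) (E4 p) = 1];
  frame_orth : forall p, strip I p ->
    [/\ dot5 eps (E1 p) (E2 p) = 0, dot5 eps (E1 p) (E3 p) = 0 &
        dot5 eps (E1 p) (E4 p) = 0] /\
    [/\ dot5 eps (E2 p) (E3 p) = 0, dot5 eps (E2 p) (E4 p) = 0 &
        dot5 eps (E3 p) (E4 p) = 0];
  frame_span : forall p Z, strip I p -> space_form_tangent eps (phi p) Z ->
    Z = dot5 eps Z (E1 p) *: E1 p + dot5 eps Z (E2 p) *: E2 p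
      + dot5 eps Z (E3 p) *: E3 p + dot5 eps Z (E4 p) *: E4 p }.

Lemma row_mulmx5 (A F : 'M[R]_5) i : row i (A *m F) =
  A i (o 0) *: row (o 0) F + A i (o 1) *: row (o 1) F + A i (o 2) *: row (o 2) F
  + A i (o 3) *: row (o 3) F + A i (o 4) *: row (o 4) F.
Proof. by rewrite row_mul mulmx_sum_row sum5 !mxE. Qed.

Lemma strip_convex (I : set R) (p q : 'rV[R]_2) (a : R) : is_interval I ->
  strip I p -> strip I q -> 0 <= a <= 1 -> strip I (a *: (q - p) + p).
Proof.
rewrite /strip /= => I_itv Ip Iq /andP[a0 a1]; rewrite !mxE.
have [pq|/ltW qp] := leP (p 0 0) (q 0 0).
  apply: (I_itv _ _ Ip Iq); apply/andP; split.
    by rewrite lerDr mulr_ge0// subr_ge0.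
  by rewrite -lerBrDr ler_piMl// subr_ge0.
apply: (I_itv _ _ Iq Ip); apply/andP; split.
  by rewrite -lerBlDr ler_niMl// subr_le0.
by rewrite gerDr mulr_ge0_le0// subr_le0.
Qed.

(** For eps < 0 this selects the upper sheet of the hyperboloid, on which the
    coordinate phi_0 cannot vanish: its sign is the sign at one point. *)
Lemma strip_pos (I : set R) (h : 'rV[R]_2 -> R) p q : is_interval I ->
  open I -> Cn 1 (strip I) h -> (forall z, strip I z -> h z != 0) ->
  strip I p -> strip I q -> 0 < h p -> 0 < h q.
Proof.
move=> I_itv I_open ch h0 Ip Iq hp; rewrite ltNge; apply/negP => hq.
pose g (a : R) : R := h (a *: (q - p) + p).
have cg : {within `[0, 1], continuous g}.
  apply: continuous_in_subspaceT => a /set_mem /=; rewrite in_itv /= => a01.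
  apply: is_derive_continuous; apply: is_derive_line.
  have [] // := Cn_derive_any (open_strip I_open) (q - p) ch (strip_convex I_itv Ip Iq a01).
have := @IVT _ g 0 1 0 ler01 cg.
rewrite /g scale0r add0r scale1r subrK => /(_ _)[|a].
  by rewrite ge_min le_max hq (ltW hp) orbT.
rewrite in_itv /= => a01 ga0.
by have := h0 _ (strip_convex I_itv Ip Iq a01); rewrite ga0 eqxx.
Qed.

(** The moving frame is started from diag(rho, 1, 1, 1, 1) instead of the
    identity, by a constant factor on the right, which leaves the differential
    equation intact and turns the conserved form into that of the space form. *)
Theorem adapted_frame_exists (eps : R) (I : set R) (v u w x y r : R -> R)
  (I_open : open I) (I_itv : is_interval I) (I_neq0 : I !=set0)
  (v_smooth : smooth1 I v)
  (wy_neq0 : forall s, I s -> 3 * w s - y s != 0)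
  (ode_u : forall s, I s ->
     is_derive s 1 u (eps + y s * (2 * w s - y s) - x s ^+ 2 + u s ^+ 2))
  (ode_w : forall s, I s ->
     is_derive s 1 w (- (w s * x s * v s / (3 * w s - y s))))
  (ode_x : forall s, I s -> is_derive s 1 x (2 * x s * u s + y s * v s))
  (ode_y : forall s, I s ->
     is_derive s 1 y (2 * u s * (y s - w s) - x s * v s))
  (ode_r : forall s, I s -> is_derive s 1 r (- (u s * r s))) :
  exists phi E1 E2 E3 E4, adapted_frame eps I v u w x y r phi E1 E2 E3 E4.
Proof.
have [s0 Is0] := I_neq0; have UO := open_strip I_open.
have [Phi [dPhi PhiD [p0 Up0 Phip0] cPhi]] := moving_frame I_open I_itv Is0
  v_smooth wy_neq0 ode_u ode_w ode_x ode_y ode_r.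
(* The value of phi_0 at the base point: the radius of the space form if
   eps <> 0; if eps = 0, then 0^-1 = 0 puts the whole frame into x_0 = 0. *)
pose rho := (Num.sqrt `|eps|)^-1.
have [F FE] : exists F, forall p, F p = Phi p *m gram_dual rho.
  by exists (fun p => Phi p *m gram_dual rho).
have rho2 : rho * eps * rho = Num.sg eps.
  rewrite /rho; have [->|e0] := eqVneq eps 0; first by rewrite mulr0 mul0r sgr0.
  rewrite mulrAC -invfM -expr2 sqr_sqrtr// {2}[eps]numEsg mulrCA mulVf ?mulr1//.
  by rewrite normr_eq0.
have FD p : strip I p -> (F p)^T *m gram_dual eps *m F p = gram_dual (Num.sg eps).
  move=> Up; rewrite FE trmx_mul tr_gram_dual -!mulmxA (mulmxA (Phi p)^T).
  by rewrite (mulmxA _ (Phi p)) PhiD// !gram_dual_mul mulrA rho2.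
have dF p d : strip I p -> is_derive p d F
    ((d 0 0 *: conn_s eps (2 * w (p 0 0) - y (p 0 0)) (x (p 0 0)) (v (p 0 0))
      + d 0 1 *: conn_t eps (r (p 0 0)) (u (p 0 0)) (x (p 0 0)) (y (p 0 0))) *m F p).
  move=> Up; rewrite FE (_ : F = (fun p => Phi p *m gram_dual rho)); last exact/funext.
  apply: (is_derive_eq (is_derive_mulmx (dPhi p d Up) (is_derive_cst (gram_dual rho) p d))).
  by rewrite mulmx0 addr0 mulmxA.
have dFrow i p d : strip I p -> is_derive p d (fun p => row i (F p))
    (row i ((d 0 0 *: conn_s eps (2 * w (p 0 0) - y (p 0 0)) (x (p 0 0)) (v (p 0 0))
      + d 0 1 *: conn_t eps (r (p 0 0)) (u (p 0 0)) (x (p 0 0)) (y (p 0 0))) *m F p)).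
  move=> Up; apply/is_derive_mxP => k j; rewrite mxE.
  under eq_fun do rewrite mxE.
  by have /is_derive_mxP := dF p d Up; exact.
have cF n i j : Cn n (strip I) (fun p => F p i j).
  rewrite (_ : F = (fun p => Phi p *m gram_dual rho)); last exact/funext.
  by apply: Cn_mulmx => // k l; exact: Cn_cst.
have sF i : smooth (strip I) (fun p => row i (F p)).
  move=> n; apply/(Cn_rowP UO) => k.
  by apply: (Cn_ext UO _ (cF n i k)) => p _; rewrite mxE.
exists (fun p => row (o 0) (F p)), (fun p => row (o 1) (F p)),
  (fun p => row (o 2) (F p)), (fun p => row (o 3) (F p)), (fun p => row (o 4) (F p)).
have tangent p i : strip I p -> i != o 0 ->
    space_form_tangent eps (row (o 0) (F p)) (row i (F p)).
  move=> Up i0; have [_ _ orth0 flat0 _] := frame_gram (FD p Up).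
  rewrite /space_form_tangent /=; case: eqVneq => e0; last exact: orth0.
  by rewrite mxE -(flat0 e0 i i0); congr (F p _ _); apply/val_inj.
split.
- move=> p d Up; apply: (is_derive_eq (dFrow (o 0) p d Up)).
  rewrite row_mulmx5 !mxE /= !(mulr0, addr0, add0r, mulr1, scale0r); done.
- move=> p d Up; apply: (is_derive_eq (dFrow (o 1) p d Up)).
  rewrite row_mulmx5 !mxE /= !(mulr0, addr0, add0r, mulr1, scale0r).
  by apply/rowP => j; rewrite !mxE; ring.
- move=> p d Up; apply: (is_derive_eq (dFrow (o 2) p d Up)).
  rewrite row_mulmx5 !mxE /= !(mulr0, addr0, add0r, mulr1, scale0r).
  by apply/rowP => j; rewrite !mxE; ring.
- move=> p d Up; apply: (is_derive_eq (dFrow (o 3) p d Up)).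
  rewrite row_mulmx5 !mxE /= !(mulr0, addr0, add0r, mulr1, scale0r).
  by apply/rowP => j; rewrite !mxE; ring.
- move=> p d Up; apply: (is_derive_eq (dFrow (o 4) p d Up)).
  rewrite row_mulmx5 !mxE /= !(mulr0, addr0, add0r, mulr1, scale0r).
  by apply/rowP => j; rewrite !mxE; ring.
- by split; exact: sF.
- move=> p Up; have [_ norm0 _ _ _] := frame_gram (FD p Up).
  rewrite /space_form /=; case: eqVneq => e0.
    rewrite mxE FE mxE sum5 !mxE /= /rho e0 normr0 sqrtr0 invr0; ring.
  split; first exact: norm0.
  move=> eneg.
  have nz q : strip I q -> F q (o 0) (o 0) != 0.
    move=> Uq; have [_ norm0q _ _ _] := frame_gram (FD q Uq).
    apply/eqP => F00; have := norm0q e0; rewrite /dot5 !mxE.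
    rewrite (_ : ord0 = o 0) ?F00; last exact: val_inj.
    rewrite !mulr0 add0r => E.
    have : 0 <= eps^-1 by rewrite -E; apply: sumr_ge0 => i _; rewrite -expr2 sqr_ge0.
    by rewrite leNgt invr_lt0 eneg.
  have := @strip_pos I (fun q => F q (o 0) (o 0)) p0 p I_itv I_open (cF 1%N _ _) nz Up0 Up.
  rewrite mxE (_ : ord0 = o 0); last exact: val_inj.
  apply; rewrite FE Phip0 mul1mx mxE /= /rho invr_gt0 sqrtr_gt0 normr_gt0 //.
- by move=> p Up; split; exact: tangent.
- move=> p Up; have [orth _ _ _ _] := frame_gram (FD p Up).
  by split; rewrite orth.
- move=> p Up; have [orth _ _ _ _] := frame_gram (FD p Up).
  by split; split; rewrite orth.
- move=> p Z Up ZT; have [_ _ _ _ span] := frame_gram (FD p Up).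
  rewrite [LHS](span Z).
    by rewrite big_mkcond sum5 /= add0r.
  move: ZT; rewrite /space_form_tangent /=; case: eqVneq => // e0 <-.
  by congr (Z _ _); apply/val_inj.
Qed.

End adapted_frame.

(** * The warped product metric *)

Section warped_metric.
Context {R : realType} (g22 : R -> R).
Local Notation G := (warped_metric g22).
Local Notation e_ i := (delta_mx 0 i : 'rV[R]_2).
Implicit Type p : 'rV[R]_2.

Lemma big_ord2 (V : nmodType) (f : 'I_2 -> V) : \sum_i f i = f 0 + f 1.
Proof. by rewrite big_ord_recl big_ord1; congr (f _ + f _); exact/val_inj. Qed.

Lemma forall_ord2 (P : 'I_2 -> Prop) : P 0 -> P 1 -> forall i, P i.
Proof.
move=> P0 P1 [[|[|//]] k]; [rewrite (_ : Ordinal k = 0)|rewrite (_ : Ordinal k = 1)] => //;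
  exact/val_inj.
Qed.

Lemma warped_metricE p (a b : 'rV[R]_2) :
  metric G p a b = a 0 0 * b 0 0 + g22 (p 0 0) * (a 0 1 * b 0 1).
Proof.
rewrite /metric /warped_metric mxE big_ord2 !mxE !big_ord2 !mxE /=.
by rewrite !(mulr0n, mulr1n, mulr0, addr0, add0r, mulr1); ring.
Qed.

Lemma invmx_warped_metric p : g22 (p 0 0) != 0 ->
  invmx (G p) = diag_mx (\row_(i < 2) if i == 0 then 1 else (g22 (p 0 0))^-1).
Proof.
move=> g0; set B := diag_mx _.
have GB : G p *m B = 1%:M.
  rewrite /warped_metric /B mulmx_diag; apply/matrixP; elim/forall_ord2;
    by elim/forall_ord2; rewrite !mxE /= ?mulr1 ?mulfV.
have [uG _] := mulmx1_unit GB.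
by rewrite -[LHS]mulmx1 -GB mulmxA mulVmx// mul1mx.
Qed.

Lemma sharp_warped p (om : 'rV[R]_2 -> R) : g22 (p 0 0) != 0 ->
  sharp G p om = om (e_ 0) *: e_ 0 + (om (e_ 1) / g22 (p 0 0)) *: e_ 1.
Proof.
move=> g0; apply/rowP; elim/forall_ord2;
  rewrite !mxE big_ord2 invmx_warped_metric // !mxE /=;
  by rewrite !(mulr0n, mulr1n, mulr0, addr0, add0r, mulr1, mul1r, mul0r)//; ring.
Qed.

Lemma metric_trace_warped (V : lmodType R) p (b : 'rV[R]_2 -> 'rV[R]_2 -> V) :
  g22 (p 0 0) != 0 ->
  metric_trace G p b = b (e_ 0) (e_ 0) + (g22 (p 0 0))^-1 *: b (e_ 1) (e_ 1).
Proof.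
move=> g0; rewrite /metric_trace !big_ord2 invmx_warped_metric // !mxE /=.
by rewrite !(mulr0n, mulr1n, scale0r, scale1r, addr0, add0r).
Qed.

Lemma delta2E (i j : 'I_2) : (delta_mx 0 i : 'rV[R]_2) 0 j = (j == i)%:R.
Proof. by rewrite mxE. Qed.

End warped_metric.

(** * Geometry of an adapted frame *)

Lemma is_derive_scale (R : realType) (V : normedModType R) m
    (f : V -> R) (Z : V -> 'rV[R]_m) p a df dZ :
  is_derive p a f df -> is_derive p a Z dZ ->
  is_derive p a (fun q => f q *: Z q) (df *: Z p + f p *: dZ).
Proof.
move=> d1 /is_derive_mxP d2; apply/is_derive_mxP => i j.
under eq_fun do rewrite mxE.
apply: (is_derive_eq (is_deriveM d1 (d2 i j))).
by rewrite !mxE /GRing.scale /=; ring.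
Qed.

Section dot5_linear.
Context {R : realType} (eps : R).
Implicit Types X Y Z : 'rV[R]_5.

Lemma dot5Dl X Y Z : dot5 eps (X + Y) Z = dot5 eps X Z + dot5 eps Y Z.
Proof. by rewrite !dot5E !mulmxDl mxE. Qed.

Lemma dot5Zl a X Z : dot5 eps (a *: X) Z = a * dot5 eps X Z.
Proof. by rewrite !dot5E -!scalemxAl mxE. Qed.

Lemma dot5Nl X Z : dot5 eps (- X) Z = - dot5 eps X Z.
Proof. by rewrite -scaleN1r dot5Zl mulN1r. Qed.

Lemma dot5Dr X Y Z : dot5 eps Z (X + Y) = dot5 eps Z X + dot5 eps Z Y.
Proof. by rewrite !(dot5C _ Z) dot5Dl. Qed.

Lemma dot5Zr a X Z : dot5 eps Z (a *: X) = a * dot5 eps Z X.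
Proof. by rewrite !(dot5C _ Z) dot5Zl. Qed.

End dot5_linear.

Section frame_geometry.
Context {R : realType} {eps : R} {I : set R} (I_open : open I)
  {v u w x y r g22 : R -> R} {phi E1 E2 E3 E4 : 'rV[R]_2 -> 'rV[R]_5}.
Context (AF : adapted_frame eps I v u w x y r phi E1 E2 E3 E4)
  (r_gt0 : forall s, I s -> 0 < r s) (r2 : forall s, I s -> r s ^+ 2 = g22 s)
  (ode_r : forall s, I s -> is_derive s 1 r (- (u s * r s))).
Local Notation U := (strip I).
Local Notation G := (warped_metric g22).
Local Notation e_ i := (delta_mx 0 i : 'rV[R]_2).
Local Notation k1 s := (2 * w s - y s).
Implicit Types (p a b : 'rV[R]_2) (Z : 'rV[R]_5).

Let UO : open U := open_strip I_open.

Let g0 p : U p -> g22 (p 0 0) != 0.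
Proof. by move=> Up; rewrite -r2// expf_neq0// gt_eqF// r_gt0. Qed.

Let r0 p : U p -> r (p 0 0) != 0.
Proof. by move=> Up; rewrite gt_eqF// r_gt0. Qed.

Lemma derive_phi p a : U p ->
  'D_a phi p = a 0 0 *: E1 p + (a 0 1 * r (p 0 0)) *: E2 p.
Proof. by move=> Up; have [_ ->] := frame_phi AF a Up. Qed.

Lemma frame_comb_dot p c1 c2 c3 c4 : U p ->
  let Z := c1 *: E1 p + c2 *: E2 p + c3 *: E3 p + c4 *: E4 p in
  [/\ dot5 eps Z (E1 p) = c1, dot5 eps Z (E2 p) = c2,
      dot5 eps Z (E3 p) = c3 & dot5 eps Z (E4 p) = c4].
Proof.
move=> Up Z; have [n1 n2 n3 n4] := frame_unit AF Up.
have [ [h12 h13 h14] [h23 h24 h34]] := frame_orth AF Up.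
by split; rewrite !dot5Dl !dot5Zl ?(dot5C _ (E2 p) (E1 p))
  ?(dot5C _ (E3 p) (E1 p)) ?(dot5C _ (E4 p) (E1 p)) ?(dot5C _ (E3 p) (E2 p))
  ?(dot5C _ (E4 p) (E2 p)) ?(dot5C _ (E4 p) (E3 p))
  ?n1 ?n2 ?n3 ?n4 ?h12 ?h13 ?h14 ?h23 ?h24 ?h34; ring.
Qed.

Lemma frame_dot_phi p Z : U p -> space_form_tangent eps (phi p) Z ->
  eps * dot5 eps Z (phi p) = 0.
Proof.
move=> Up; rewrite /space_form_tangent /=.
by case: eqVneq => [e0 _|_ ->]; rewrite ?mulr0// {1}e0 mul0r.
Qed.

Lemma frame_phi_phi p : U p -> eps * (eps * dot5 eps (phi p) (phi p)) = eps.
Proof.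
move=> Up; have := frame_space AF Up; rewrite /space_form /=.
case: eqVneq => [e0 _|e0 [-> _]]; first by rewrite {1}e0 mul0r e0.
by rewrite mulfV// mulr1.
Qed.

Lemma normal_part_frame p c1 c2 c3 c4 : U p ->
  normal_part eps G phi p (c1 *: E1 p + c2 *: E2 p + c3 *: E3 p + c4 *: E4 p)
  = c3 *: E3 p + c4 *: E4 p.
Proof.
move=> Up; rewrite /normal_part; set Z := _ + _ *: E4 p.
have [d1 d2 _ _] := frame_comb_dot c1 c2 c3 c4 Up.
rewrite sharp_warped ?g0// !derive_phi// !delta2E /= !mxE /=.
rewrite !dot5Dr !dot5Zr d1 d2 /Z.
rewrite -r2//; have := r0 Up; move: (r (p 0 0)) => rho rn.
by apply/rowP => j; rewrite !mxE /=; field.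
Qed.

(** Every normal covariant derivative below is computed in this way: expand the
    derivative in R^5 in the frame, then drop the components along phi, which is
    normal to the space form, and along E1, E2, which are tangent to the surface. *)
Lemma normal_proj p a (Z : 'rV[R]_2 -> 'rV[R]_5) c1 c2 c3 c4 m : U p ->
  'D_a Z p = c1 *: E1 p + c2 *: E2 p + c3 *: E3 p + c4 *: E4 p
             - (eps * m) *: phi p ->
  normal_part eps G phi p (space_form_conn eps phi a Z p)
  = c3 *: E3 p + c4 *: E4 p.
Proof.
move=> Up DZ; rewrite -(normal_part_frame c1 c2 c3 c4 Up) /space_form_conn DZ.
congr (normal_part _ _ _ _ _).
have [t1 t2 t3 t4] := frame_tangent AF Up.
set T := _ + _ *: E4 p.
have -> : eps * dot5 eps (T - (eps * m) *: phi p) (phi p) = - (eps * m).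
  rewrite dot5Dl dot5Nl dot5Zl !dot5Dl !dot5Zl.
  have := frame_phi_phi Up; have := frame_dot_phi Up t4.
  have := frame_dot_phi Up t3; have := frame_dot_phi Up t2.
  have := frame_dot_phi Up t1.
  move: (dot5 _ _ _) (dot5 _ _ _) (dot5 _ _ _) (dot5 _ _ _) (dot5 _ _ _).
  move=> q5 q4 q3 q2 q1 Q1 Q2 Q3 Q4 Q5.
  transitivity (c1 * (eps * q1) + c2 * (eps * q2) + c3 * (eps * q3)
    + c4 * (eps * q4) - m * (eps * (eps * q5))); first by ring.
  by rewrite Q1 Q2 Q3 Q4 Q5; ring.
by rewrite scaleNr opprK subrK.
Qed.

Lemma second_form_frame p a b : U p ->
  second_form eps G phi p a b =
  (a 0 0 * b 0 0 * k1 (p 0 0) + a 0 1 * b 0 1 * (r (p 0 0) ^+ 2 * y (p 0 0)))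
    *: E3 p
  + (a 0 0 * b 0 0 * x (p 0 0) - a 0 1 * b 0 1 * (r (p 0 0) ^+ 2 * x (p 0 0)))
    *: E4 p.
Proof.
move=> Up; rewrite /second_form.
set c3 := _ + _ * (_ * y _); set c4 := _ - _.
have dr : is_derive p a (fun q => b 0 1 * r (q 0 0))
    (b 0 1 * (a 0 0 * - (u (p 0 0) * r (p 0 0)))).
  exact: is_deriveZ (is_derive_coord a (ode_r Up)).
pose Z q := b 0 0 *: E1 q + (b 0 1 * r (q 0 0)) *: E2 q.
have dZ := is_deriveD (is_deriveZ (b 0 0) (frame_E1 AF a Up))
  (is_derive_scale dr (frame_E2 AF a Up)).
have ZE : 'D_a (fun q => 'D_b phi q) p = 'D_a Z p.
  by apply: (eq_on_derive UO _ Up) => q Uq; rewrite derive_phi.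
apply: (@normal_proj p a _ (a 0 1 * b 0 1 * (r (p 0 0) ^+ 2 * u (p 0 0)))
  (- ((a 0 0 * b 0 1 + a 0 1 * b 0 0) * r (p 0 0) * u (p 0 0))) c3 c4
  (a 0 0 * b 0 0 + a 0 1 * b 0 1 * r (p 0 0) ^+ 2) Up).
rewrite ZE; have [_ ->] := dZ.
by rewrite /c3 /c4; apply/rowP => j; rewrite !mxE /=; ring.
Qed.

Lemma mean_curvature_frame p : U p ->
  mean_curvature eps G phi p = w (p 0 0) *: E3 p.
Proof.
move=> Up; rewrite /mean_curvature metric_trace_warped ?g0// !second_form_frame//.
rewrite !delta2E /= -r2//; have := r0 Up; move: (r (p 0 0)) => rho rn.
by apply/rowP => j; rewrite !mxE /=; field.
Qed.

Lemma normal_conn_frame (X : 'rV[R]_2 -> 'rV[R]_2) (eta : 'rV[R]_2 -> 'rV[R]_5)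
    (h3 h4 : 'rV[R]_2 -> R) p D3 D4 : U p ->
  is_derive p (X p) h3 D3 -> is_derive p (X p) h4 D4 ->
  (forall q, U q -> eta q = h3 q *: E3 q + h4 q *: E4 q) ->
  normal_conn eps G phi X eta p =
  (D3 - X p 0 0 * v (p 0 0) * h4 p) *: E3 p
  + (D4 + X p 0 0 * v (p 0 0) * h3 p) *: E4 p.
Proof.
move=> Up d3 d4 etaE; rewrite /normal_conn.
set c3 := D3 - _; set c4 := D4 + _.
have dZ := is_deriveD (is_derive_scale d3 (frame_E3 AF (X p) Up))
  (is_derive_scale d4 (frame_E4 AF (X p) Up)).
apply: (@normal_proj p (X p) _
  (- X p 0 0 * (h3 p * k1 (p 0 0) + h4 p * x (p 0 0)))
  (X p 0 1 * r (p 0 0) * (h4 p * x (p 0 0) - h3 p * y (p 0 0))) c3 c4 0 Up).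
rewrite (eq_on_derive UO _ Up etaE); have [_ ->] := dZ.
by rewrite /c3 /c4; apply/rowP => j; rewrite !mxE /=; ring.
Qed.

Lemma shape_operator_frame p a n3 n4 : U p ->
  shape_operator eps G phi (n3 *: E3 p + n4 *: E4 p) p a =
  (a 0 0 * (k1 (p 0 0) * n3 + x (p 0 0) * n4)) *: e_ 0
  + (a 0 1 * (y (p 0 0) * n3 - x (p 0 0) * n4)) *: e_ 1.
Proof.
move=> Up; rewrite /shape_operator sharp_warped ?g0// !second_form_frame//.
rewrite !delta2E /= -r2//.
have [n33 n44] : dot5 eps (E3 p) (E3 p) = 1 /\ dot5 eps (E4 p) (E4 p) = 1.
  by have [] := frame_unit AF Up.
have n34 : dot5 eps (E3 p) (E4 p) = 0 by have [_ []] := frame_orth AF Up.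
rewrite !dot5Dl !dot5Zl !dot5Dr !dot5Zr (dot5C _ (E4 p) (E3 p)) n33 n44 n34.
have := r0 Up; move: (r (p 0 0)) => rho rn.
by apply/rowP => j; rewrite !mxE /=; field.
Qed.

End frame_geometry.

(** * Flatness of the normal bundle *)

Section flat_normal.
Context {R : realType} {eps : R} {I : set R} (I_open : open I)
  {v u w x y r g22 : R -> R} {phi E1 E2 E3 E4 : 'rV[R]_2 -> 'rV[R]_5}.
Context (AF : adapted_frame eps I v u w x y r phi E1 E2 E3 E4)
  (r_gt0 : forall s, I s -> 0 < r s) (r2 : forall s, I s -> r s ^+ 2 = g22 s)
  (v_smooth : smooth1 I v).
Local Notation U := (strip I).
Local Notation G := (warped_metric g22).
Local Notation e_ i := (delta_mx 0 i : 'rV[R]_2).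
Let UO : open U := open_strip I_open.

Lemma Cn_dot5 n (Z T : 'rV[R]_2 -> 'rV[R]_5) :
  Cn n U Z -> Cn n U T -> Cn n U (fun q => dot5 eps (Z q) (T q)).
Proof.
move=> /(Cn_rowP UO) cZ /(Cn_rowP UO) cT; rewrite /dot5; apply: CnD => //.
  by apply: CnM => //; [exact: Cn_cst|apply: CnM].
by apply: Cn_sum => // i; apply: CnM.
Qed.

Lemma normal_field_frame (eta : 'rV[R]_2 -> 'rV[R]_5) p :
  normal_field eps U phi eta -> U p ->
  eta p = dot5 eps (eta p) (E3 p) *: E3 p + dot5 eps (eta p) (E4 p) *: E4 p.
Proof.
move=> [_ etaN] Up; have [etaT eta0] := etaN p Up.
rewrite [LHS](frame_span AF Up etaT).
have := eta0 (e_ 0); rewrite (derive_phi AF _ Up) !delta2E /= mul0r scale0r addr0.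
rewrite scale1r => ->.
have := eta0 (e_ 1); rewrite (derive_phi AF _ Up) !delta2E /= scale0r add0r mul1r.
rewrite dot5Zr => /eqP; rewrite mulf_eq0 gt_eqF ?r_gt0//= => /eqP ->.
by rewrite !scale0r !add0r.
Qed.

(** In the frame E3, E4 the normal connection is d + v ds J with J the rotation
    by a right angle: the curvature terms of v cancel because ds /\ ds = 0 and
    v depends on s alone, and those of the components because second
    derivatives commute. *)
Lemma flat_normal_bundle_frame : flat_normal_bundle eps U G phi.
Proof.
move=> X Y eta sX sY etaN p Up.
have [_ _ _ sE3 sE4] := frame_smooth AF.
pose h3 q := dot5 eps (eta q) (E3 q); pose h4 q := dot5 eps (eta q) (E4 q).
have etaE q : U q -> eta q = h3 q *: E3 q + h4 q *: E4 q.
  by move=> Uq; exact: normal_field_frame.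
have ch3 n : Cn n U h3 by apply: Cn_dot5; [exact: etaN.1|exact: sE3].
have ch4 n : Cn n U h4 by apply: Cn_dot5; [exact: etaN.1|exact: sE4].
have [h3O h4O] : (forall n, Cn n U h3) /\ (forall n, Cn n U h4) by [].
clearbody h3 h4.
pose D i (h : 'rV[R]_2 -> R) q := 'D_(e_ i) h q.
have dv (d : 'rV[R]_2) : is_derive p d (fun q => v (q 0 0)) (d 0 0 * derive1 v (p 0 0)).
  apply: is_derive_coord; rewrite derive1E; apply: derivableP.
  exact: (v_smooth (n := 0) Up).
pose A (Z : 'rV[R]_2 -> 'rV[R]_2) q :=
  Z q 0 0 * (D 0 h3 q - v (q 0 0) * h4 q) + Z q 0 1 * D 1 h3 q.
pose B (Z : 'rV[R]_2 -> 'rV[R]_2) q :=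
  Z q 0 0 * (D 0 h4 q + v (q 0 0) * h3 q) + Z q 0 1 * D 1 h4 q.
have once Z q : U q ->
    normal_conn eps G phi Z eta q = A Z q *: E3 q + B Z q *: E4 q.
  move=> Uq.
  rewrite (normal_conn_frame I_open AF r_gt0 r2 Uq
    (Cn_derive_any UO (Z q) (ch3 1%N) Uq) (Cn_derive_any UO (Z q) (ch4 1%N) Uq) etaE).
  by rewrite /A /B /D; congr (_ *: _ + _ *: _); ring.
have comp (Z : 'rV[R]_2 -> 'rV[R]_2) i (d : 'rV[R]_2) : smooth U Z ->
    is_derive p d (fun q => Z q 0 i) (('D_d Z p) 0 i).
  move=> sZ; have /(Cn_rowP UO) cZ := sZ 1%N.
  have dZ : is_derive p d Z ('D_d Z p).
    apply: derivableP; apply/derivable_mxP => k l; rewrite ord1.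
    by have [] := Cn_derive_any UO d (cZ l) Up.
  by have /is_derive_mxP := dZ; exact.
pose D' (d : 'rV[R]_2) (h : 'rV[R]_2 -> R) : R := d 0 0 * D 0 h p + d 0 1 * D 1 h p.
have dh d (h : 'rV[R]_2 -> R) : (forall n, Cn n U h) -> is_derive p d h (D' d h).
  by move=> ch; exact: (Cn_derive_any UO d (ch 1%N) Up).
have cD (h : 'rV[R]_2 -> R) i : (forall n, Cn n U h) -> forall n, Cn n U (D i h).
  by move=> ch n; exact: (Cn_derive i (ch n.+1)).
have twice (Z T : 'rV[R]_2 -> 'rV[R]_2) : smooth U Z ->
  normal_conn eps G phi T (normal_conn eps G phi Z eta) p =
  (('D_(T p) Z p) 0 0 * (D 0 h3 p - v (p 0 0) * h4 p)
   + Z p 0 0 * (D' (T p) (D 0 h3)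
       - (T p 0 0 * derive1 v (p 0 0) * h4 p + v (p 0 0) * D' (T p) h4))
   + ('D_(T p) Z p) 0 1 * D 1 h3 p + Z p 0 1 * D' (T p) (D 1 h3)
   - T p 0 0 * v (p 0 0) * B Z p) *: E3 p
  + (('D_(T p) Z p) 0 0 * (D 0 h4 p + v (p 0 0) * h3 p)
   + Z p 0 0 * (D' (T p) (D 0 h4)
       + (T p 0 0 * derive1 v (p 0 0) * h3 p + v (p 0 0) * D' (T p) h3))
   + ('D_(T p) Z p) 0 1 * D 1 h4 p + Z p 0 1 * D' (T p) (D 1 h4)
   + T p 0 0 * v (p 0 0) * A Z p) *: E4 p.
  move=> sZ.
  have dA := is_deriveD
    (is_deriveM (comp Z 0 (T p) sZ)
      (is_deriveB (dh _ _ (cD h3 0 h3O)) (is_deriveM (dv _) (dh _ _ h4O))))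
    (is_deriveM (comp Z 1 (T p) sZ) (dh _ _ (cD h3 1 h3O))).
  have dB := is_deriveD
    (is_deriveM (comp Z 0 (T p) sZ)
      (is_deriveD (dh _ _ (cD h4 0 h4O)) (is_deriveM (dv _) (dh _ _ h3O))))
    (is_deriveM (comp Z 1 (T p) sZ) (dh _ _ (cD h4 1 h4O))).
  have once' q (Uq : U q) := once Z q Uq.
  rewrite (normal_conn_frame (X := T) I_open AF r_gt0 r2 Up dA dB once').
  rewrite /A /B; congr (_ *: _ + _ *: _); rewrite /GRing.scale /= !fctE /=.
    move: (D' _ _) (D' _ _) (D' _ _).
    move: (D _ _ _) (D _ _ _) (D _ _ _) ('D_(T p) Z p) (derive1 v _).
    by move: (v _) (h3 p) (h4 p) => *; ring.
  move: (D' _ _) (D' _ _) (D' _ _).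
  move: (D _ _ _) (D _ _ _) (D _ _ _) ('D_(T p) Z p) (derive1 v _).
  by move: (v _) (h3 p) (h4 p) => *; ring.
have sym h : (forall n, Cn n U h) -> D 1 (D 0 h) p = D 0 (D 1 h) p.
  by move=> ch; exact: (Cn_derive_sym UO 0 1 (ch 2) Up).
rewrite /normal_curvature (twice Y X sY) (twice X Y sX) once//.
rewrite /A /B /D' (sym h3 h3O) (sym h4 h4O) /lie_bracket !mxE.
move: ('D_(X p) Y p) ('D_(Y p) X p) => YX XY.
move: (D 0 (D 0 h3) p) (D 0 (D 1 h3) p) (D 1 (D 1 h3) p) => a1 a2 a3.
move: (D 0 (D 0 h4) p) (D 0 (D 1 h4) p) (D 1 (D 1 h4) p) => b1 b2 b3.
move: (D _ _ _) (D _ _ _) (D _ _ _) (D _ _ _) (v _) (h3 p) (h4 p) (derive1 v _) => *.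
by apply/rowP => j; rewrite !mxE; ring.
Qed.

End flat_normal.

(** * Curvature of the warped product metric *)

Section warped_curvature.
Context {R : realType} {I : set R} (I_open : open I) {u du g22 : R -> R}
  (g22_gt0 : forall s, I s -> 0 < g22 s)
  (ode_u : forall s, I s -> is_derive s 1 u (du s))
  (ode_g22 : forall s, I s -> is_derive s 1 g22 (- 2 * u s * g22 s)).
Local Notation U := (strip I).
Local Notation G := (warped_metric g22).
Local Notation e_ i := (delta_mx 0 i : 'rV[R]_2).
Implicit Types p q : 'rV[R]_2.
Let UO : open U := open_strip I_open.

Let g0 p : U p -> g22 (p 0 0) != 0.
Proof. by move=> Up; rewrite gt_eqF// g22_gt0. Qed.

Lemma derive_warped_metric p i j l : U p ->
  'D_(e_ i) (fun q => G q j l) p =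
  if [&& i == 0, j == 1 & l == 1] then - 2 * u (p 0 0) * g22 (p 0 0) else 0.
Proof.
move=> Up; have dg := is_derive_coord (e_ i) (ode_g22 Up).
have const (h : 'rV[R]_2 -> R) (c : R) : (forall q, h q = c) -> 'D_(e_ i) h p = 0.
  by move=> hc; rewrite (_ : h = cst c) ?derive_cst//; exact/funext.
move: j l; elim/forall_ord2; elim/forall_ord2; rewrite /= ?andbF ?andbT.
- by apply: (const _ 1) => q; rewrite !mxE /= mulr1n.
- by apply: (const _ 0) => q; rewrite !mxE /= mulr0n.
- by apply: (const _ 0) => q; rewrite !mxE /= mulr0n.
- under eq_fun do rewrite !mxE /= mulr1n.
  have [_ ->] := dg; rewrite delta2E eq_sym; case: eqP => _.
    by rewrite mul1r.
  by rewrite mul0r.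
Qed.

Lemma christoffel_warped p i j k : U p ->
  christoffel G i j k p =
  if k == 0 then if (i == 1) && (j == 1) then u (p 0 0) * g22 (p 0 0) else 0
  else if i == j then 0 else - u (p 0 0).
Proof.
move=> Up; rewrite /christoffel big_ord2 !derive_warped_metric//.
rewrite invmx_warped_metric ?g0// !mxE; have := g0 Up.
move: (g22 (p 0 0)) (u (p 0 0)) => g a gn.
by move: i j k; do 3!elim/forall_ord2; rewrite /= ?mulr0n ?mulr1n; field.
Qed.

Lemma levi_civita_warped (X Y : 'rV[R]_2 -> 'rV[R]_2) p : U p ->
  levi_civita G X Y p = 'D_(X p) Y p
    + (X p 0 1 * Y p 0 1 * (u (p 0 0) * g22 (p 0 0))) *: e_ 0
    - ((X p 0 0 * Y p 0 1 + X p 0 1 * Y p 0 0) * u (p 0 0)) *: e_ 1.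
Proof.
move=> Up; rewrite /levi_civita -addrA; congr (_ + _).
apply/rowP => k; rewrite mxE !big_ord2 !christoffel_warped//.
by move: k; elim/forall_ord2; rewrite !mxE /=; ring.
Qed.

(** The curvature of ds^2 + r^2 dt^2 is - r'' / r, and r' = - u r. *)
Lemma gauss_curvature_warped p : U p ->
  gauss_curvature G p = du (p 0 0) - u (p 0 0) ^+ 2.
Proof.
move=> Up; rewrite /gauss_curvature /=.
set d1 : 'rV[R]_2 := delta_mx 0 0; set d2 : 'rV[R]_2 := delta_mx 0 1.
have cst_conn (a b : 'rV[R]_2) q : U q ->
    levi_civita G (cst a) (cst b) q =
    (a 0 1 * b 0 1 * (u (q 0 0) * g22 (q 0 0))) *: e_ 0
    - ((a 0 0 * b 0 1 + a 0 1 * b 0 0) * u (q 0 0)) *: e_ 1.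
  by move=> Uq; rewrite levi_civita_warped// derive_cst add0r.
have c22 q : U q -> levi_civita G (cst d2) (cst d2) q = (u (q 0 0) * g22 (q 0 0)) *: e_ 0.
  by move=> Uq; rewrite cst_conn//; apply/rowP => j; rewrite !mxE /=; ring.
have c12 q : U q -> levi_civita G (cst d1) (cst d2) q = - u (q 0 0) *: e_ 1.
  by move=> Uq; rewrite cst_conn//; apply/rowP => j; rewrite !mxE /=; ring.
have du2 d : is_derive p d (fun q => u (q 0 0)) (d 0 0 * du (p 0 0)).
  exact: is_derive_coord (ode_u Up).
have dg2 d : is_derive p d (fun q => g22 (q 0 0)) (d 0 0 * (- 2 * u (p 0 0) * g22 (p 0 0))).
  exact: is_derive_coord (ode_g22 Up).
have R1 : levi_civita G (cst d1) (levi_civita G (cst d2) (cst d2)) p =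
    (du (p 0 0) * g22 (p 0 0) - 2 * u (p 0 0) ^+ 2 * g22 (p 0 0)) *: e_ 0.
  rewrite levi_civita_warped// (eq_on_derive UO _ Up c22) c22//.
  have [_ ->] := is_derive_scale (is_deriveM (du2 d1) (dg2 d1)) (is_derive_cst (e_ 0) p d1).
  by apply/rowP => j; rewrite /GRing.scale /= !mxE /=; ring.
have R2 : levi_civita G (cst d2) (levi_civita G (cst d1) (cst d2)) p =
    (- u (p 0 0) ^+ 2 * g22 (p 0 0)) *: e_ 0.
  rewrite levi_civita_warped// (eq_on_derive UO _ Up c12) c12//.
  have [_ ->] := is_derive_scale (is_deriveN (du2 d2)) (is_derive_cst (e_ 1) p d2).
  by apply/rowP => j; rewrite /GRing.scale /= !mxE /=; ring.
have br : lie_bracket (cst d1) (cst d2) p = 0.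
  by rewrite /lie_bracket !derive_cst subrr.
rewrite /riemann R1 R2 levi_civita_warped// br derive0.
rewrite warped_metricE /warped_metric det_diag big_ord_recl big_ord1 !mxE /=.
have := g0 Up; move: (g22 _) (u _) (du _) => g a b gn.
by field.
Qed.

End warped_curvature.

(** * The immersion theorem *)

Section conclusion_lemmas.
Context {R : realType}.
Local Notation e_ i := (delta_mx 0 i : 'rV[R]_2).
Implicit Types p : 'rV[R]_2.

Lemma delta2_neq0 (i : 'I_2) : e_ i != 0.
Proof. by apply/eqP => /rowP/(_ i)/eqP; rewrite !mxE !eqxx /= oner_eq0. Qed.

Lemma derive_e1_coord0 (b : R -> R) p :
  'D_(e_ 1) (fun q : 'rV[R]_2 => b (q 0 0)) p = 0.
Proof.
rewrite /derive (_ : (fun k => _) = cst 0); last first.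
  by apply/funext => k; rewrite /= !mxE mulr0 add0r subrr scaler0.
by apply: lim_cst.
Qed.

Lemma not_free_line (a b : R) (z : 'rV[R]_2) : ~~ free [:: a *: z; b *: z].
Proof.
rewrite free_cons span_seq1 seq1_free; have [->|b0] := eqVneq b 0.
  by rewrite scale0r eqxx andbF.
rewrite negb_and negbK; apply/orP; left; apply/vlineP; exists (a / b).
by rewrite scalerA divfK.
Qed.

Lemma is_derive_sqrt_comp (g : R -> R) (s a : R) : 0 < g s ->
  is_derive s 1 g (- 2 * a * g s) ->
  is_derive s 1 (fun s => Num.sqrt (g s)) (- (a * Num.sqrt (g s))).
Proof.
move=> gs dg; have ds := @is_derive1_sqrt R (g s) gs.
have d := @is_derive1_comp R Num.sqrt g s _ _ ds dg.
have -> : - (a * Num.sqrt (g s)) = (2 * Num.sqrt (g s))^-1 * (- 2 * a * g s).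
  have := sqr_sqrtr (ltW gs); have : Num.sqrt (g s) != 0 by rewrite gt_eqF// sqrtr_gt0.
  by move: (g s) (Num.sqrt (g s)) => z t t0 <-; field.
exact: d.
Qed.

(** A zero of y - w with nonzero derivative is isolated. The points where A3 is
    f Id are of this kind. *)
Lemma y_neq_w_dense (I : set R) (y w : R -> R) (dy dw : R) p (B : set 'rV[R]_2) :
  open I -> strip I p -> nbhs p B ->
  is_derive (p 0 0) 1 y dy -> is_derive (p 0 0) 1 w dw ->
  dy != dw ->
  exists q, [/\ strip I q, B q & y (q 0 0) != w (q 0 0)].
Proof.
move=> I_open Up pB Dy Dw; apply: contra_neqP => nq.
have [e e0 eP] := nbhs_rV2P (filterI (open_nbhs_nbhs (conj (open_strip I_open) Up)) pB).
have yw : \forall s \near p 0 0, (y - w) s = cst 0 s.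
  near=> s.
  have [Uq Bq] : strip I ((s - p 0 0) *: e_ 0 + p) /\ B ((s - p 0 0) *: e_ 0 + p).
    apply: eP => i; rewrite !mxE addrK.
    have se : `|s - p 0 0| < e by rewrite distrC; near: s; exact: cvgr_dist_lt.
    by case: (i == 0); rewrite ?mulr1 // mulr0 normr0.
  rewrite /= fctE /cst; apply/eqP; rewrite subr_eq0; apply/negP => /negP sw.
  apply: nq; exists ((s - p 0 0) *: e_ 0 + p); split => //.
  by rewrite !mxE /= mulr1 subrK.
have [_ D1] := is_deriveB Dy Dw.
have := @near_eq_derive _ _ _ _ _ (p 0 0) 1 yw; rewrite derive_cst D1.
by move/eqP; rewrite subr_eq0 => /eqP.
Unshelve. all: by end_near. Qed.

End conclusion_lemmas.

Unset Implicit Arguments.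

Theorem theorem3p11 (R : realType) (eps : R) (I : set R)
  (v u w x y g22 : R -> R)
  (I_open : open I) (I_itv : is_interval I) (I_neq0 : I !=set0)
  (v_smooth : smooth1 I v) (v_neq0 : forall s, I s -> v s != 0)
  (u_neq0 : forall s, I s -> u s != 0)
  (w_gt0 : forall s, I s -> 0 < w s)
  (x_gt0 : forall s, I s -> 0 < x s)
  (wy_neq0 : forall s, I s -> 3 * w s - y s != 0)
  (wyx_neq0 : forall s, I s ->
     3 * w s ^+ 2 + y s * (2 * w s - y s) - x s ^+ 2 != 0)
  (dw_gt0 : forall s, I s -> 0 < w^`() s)
  (ode_u : forall s, I s ->
     is_derive s 1 u (eps + y s * (2 * w s - y s) - x s ^+ 2 + u s ^+ 2))
  (ode_w : forall s, I s ->
     is_derive s 1 w (- (w s * x s * v s / (3 * w s - y s))))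
  (ode_x : forall s, I s -> is_derive s 1 x (2 * x s * u s + y s * v s))
  (ode_y : forall s, I s ->
     is_derive s 1 y (2 * u s * (y s - w s) - x s * v s))
  (g22_gt0 : forall s, I s -> 0 < g22 s)
  (ode_g22 : forall s, I s -> is_derive s 1 g22 (- 2 * u s * g22 s)) :
  let U := strip I in
  let G := warped_metric g22 in
  let K := gauss_curvature G in
  let E1 := frame1 in
  let E2 := frame2 g22 in
  exists phi E4 : 'rV[R]_2 -> 'rV[R]_5,
    let H := mean_curvature eps G phi in
    let f := mean_curvature_norm eps G phi in
    let E3 := unit_mean_curvature eps G phi in
    let A3 (p : 'rV[R]_2) := shape_operator eps G phi (E3 p) p in
    let A4 (p : 'rV[R]_2) := shape_operator eps G phi (E4 p) p in
    let Dperp := normal_conn eps G phi in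
    [/\ isometric_immersion eps U G phi,
        biconservative eps U G phi,
        normal_field eps U phi E4 /\
          (forall p, U p ->
             dot5 eps (E4 p) (E4 p) = 1 /\ dot5 eps (E4 p) (E3 p) = 0) &
    [/\ [/\ forall p, U p ->
              [/\ 3 * f p ^+ 2 + K p - eps != 0, H p != 0, grad G f p != 0,
                  (exists a, A4 p a != 0) &
                  levi_civita G E2 E2 p != 0],
            forall p, U p -> y (p 0 0) != w (p 0 0) ->
              exists a, A3 p a != f p *: a &
            U `<=` closure [set p | U p /\ exists a, A3 p a != f p *: a]],
        flat_normal_bundle eps U G phi /\
          (forall p, U p -> ~~ free [:: grad G f p; grad G K p]),
        [/\ forall p, U p -> Dperp E1 E3 p = v (p 0 0) *: E4 p,
            forall p, U p -> Dperp E1 E3 p != 0,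
            forall p, U p -> Dperp E2 E3 p = 0 &
            ~ PNMC eps U G phi] &
        exists k1 k2 alpha a2 b1 : 'rV[R]_2 -> R,
          (forall p, U p ->
             [/\ A3 p (E1 p) = k1 p *: E1 p /\ A3 p (E2 p) = k2 p *: E2 p,
                 A4 p (E1 p) = alpha p *: E1 p,
                 A4 p (E2 p) = - alpha p *: E2 p,
                 levi_civita G E2 E2 p = a2 p *: E1 p &
                 b1 p = dot5 eps (Dperp E1 E3 p) (E4 p)]) /\
          (forall p, U p ->
             [/\ f p = w (p 0 0), k2 p = y (p 0 0), alpha p = x (p 0 0),
                 a2 p = u (p 0 0) & b1 p = v (p 0 0)])]].
Proof.
have UO : open (strip I) := open_strip I_open.
pose r s := Num.sqrt (g22 s).
have r_gt0 s : I s -> 0 < r s by move=> Is; rewrite sqrtr_gt0 g22_gt0.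
have r2 s : I s -> r s ^+ 2 = g22 s by move=> Is; rewrite sqr_sqrtr// ltW// g22_gt0.
have ode_r s (Is : I s) : is_derive s 1 r (- (u s * r s)).
  by apply: is_derive_sqrt_comp; [exact: g22_gt0|exact: ode_g22].
have [phi [E1' [E2' [E3' [E4 AF]]]]] := @adapted_frame_exists R eps I v u w x y r
  I_open I_itv I_neq0 v_smooth wy_neq0 ode_u ode_w ode_x ode_y ode_r.
move=> U G K E1 E2; exists phi, E4 => H f E3 A3 A4 Dperp.
have g0 p : U p -> g22 (p 0 0) != 0 by move=> Up; rewrite gt_eqF// g22_gt0.
have w0 p : U p -> w (p 0 0) != 0 by move=> Up; rewrite gt_eqF// w_gt0.
have dot50 (Z : 'rV[R]_5) : dot5 eps 0 Z = 0.
  by rewrite -(scale0r Z) dot5Zl mul0r.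
have unit p : U p -> [/\ dot5 eps (E1' p) (E1' p) = 1, dot5 eps (E2' p) (E2' p) = 1,
    dot5 eps (E3' p) (E3' p) = 1 & dot5 eps (E4 p) (E4 p) = 1].
  by move=> Up; exact: (frame_unit AF Up).
have HE p : U p -> H p = w (p 0 0) *: E3' p.
  by move=> Up; exact: (mean_curvature_frame I_open AF r_gt0 r2 ode_r Up).
have fE p : U p -> f p = w (p 0 0).
  move=> Up; rewrite /f /mean_curvature_norm -/(H p) HE// dot5Zl dot5Zr.
  have [_ _ -> _] := unit p Up.
  by rewrite mulr1 -expr2 sqrtr_sqr gtr0_norm// w_gt0.
have E3E p : U p -> E3 p = E3' p.
  move=> Up; rewrite /E3 /unit_mean_curvature -/(f p) -/(H p) fE// HE//.
  by rewrite scalerA mulVf ?w0// scale1r.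
have E4_neq0 p : U p -> E4 p != 0.
  move=> Up; have [_ _ _ n4] := unit p Up; apply/eqP => E40.
  by move: n4; rewrite E40 dot50 => /esym/eqP; rewrite oner_eq0.
have A3E p a : U p -> A3 p a =
    (a 0 0 * (2 * w (p 0 0) - y (p 0 0))) *: delta_mx 0 0
    + (a 0 1 * y (p 0 0)) *: delta_mx 0 1.
  move=> Up; have -> : A3 p a = shape_operator eps G phi (1 *: E3' p + 0 *: E4 p) p a.
    by rewrite /A3 E3E// scale1r scale0r addr0.
  rewrite (shape_operator_frame I_open AF r_gt0 r2 ode_r _ _ _ Up).
  by congr (_ *: _ + _ *: _); ring.
have A3n q : U q -> y (q 0 0) != w (q 0 0) -> exists a, A3 q a != f q *: a.
  move=> Uq yw; exists (delta_mx 0 1); rewrite A3E// fE// !mxE /=.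
  rewrite mul0r scale0r add0r mul1r -subr_eq0 -scalerBl scaler_eq0 negb_or.
  by rewrite subr_eq0 yw delta2_neq0.
have A4E p a : U p -> A4 p a =
    (a 0 0 * x (p 0 0)) *: delta_mx 0 0 - (a 0 1 * x (p 0 0)) *: delta_mx 0 1.
  move=> Up; have -> : A4 p a = shape_operator eps G phi (0 *: E3' p + 1 *: E4 p) p a.
    by rewrite /A4 scale1r scale0r add0r.
  rewrite (shape_operator_frame I_open AF r_gt0 r2 ode_r _ _ _ Up).
  by apply/rowP => j; rewrite !mxE; ring.
have DperpE3 (X : 'rV[R]_2 -> 'rV[R]_2) p : U p ->
    Dperp X E3 p = (X p 0 0 * v (p 0 0)) *: E4 p.
  move=> Up.
  have E3s q (Uq : U q) : E3 q = cst 1 q *: E3' q + cst 0 q *: E4 q.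
    by rewrite E3E// /cst scale1r scale0r addr0.
  rewrite /Dperp (normal_conn_frame (X := X) I_open AF r_gt0 r2 Up
    (is_derive_cst (1 : R) p (X p)) (is_derive_cst (0 : R) p (X p)) E3s).
  by rewrite /cst mulr0 subrr scale0r mulr1 !add0r.
have E2E p : U p -> levi_civita G E2 E2 p = u (p 0 0) *: E1 p.
  move=> Up; rewrite (levi_civita_warped g22_gt0 ode_g22 _ _ Up).
  have ds : is_derive (p 0 0) 1 (fun s => (r s)^-1) (- (r (p 0 0))^-1 ^+ 2 * - (u (p 0 0) * r (p 0 0))).
    by apply: is_derive_inv; [rewrite gt_eqF// r_gt0|exact: ode_r].
  have d := is_derive_scale (is_derive_coord (E2 p) ds)
    (is_derive_cst (delta_mx 0 1 : 'rV[R]_2) p (E2 p)).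
  have -> : 'D_(E2 p) E2 p = 0.
    have [_ DE] := d; rewrite [LHS]DE /E2 /frame2 !mxE /= mulr0 mul0r.
    by rewrite scale0r scaler0 addr0.
  have rn : r (p 0 0) != 0 by rewrite gt_eqF// r_gt0.
  rewrite /E2 /frame2 /E1 /frame1 -/(r (p 0 0)) -(r2 _ Up).
  move: (r (p 0 0)) rn => rho rn.
  by apply/rowP => j; rewrite !mxE /=; field.
have dw p d : U p -> 'D_d f p = d 0 0 * derive1 w (p 0 0).
  move=> Up; rewrite (eq_on_derive UO _ Up fE).
  have [dwp _] := ode_w _ Up.
  have [_ ->] // := is_derive_coord (p := p) d (derivableP dwp).
  by rewrite derive1E.
have gradf p : U p -> grad G f p = derive1 w (p 0 0) *: delta_mx 0 0.
  move=> Up; rewrite /grad sharp_warped ?g0// !dw// !mxE /=.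
  by rewrite mul1r !mul0r scale0r addr0.
have KE p : U p -> K p = eps + y (p 0 0) * (2 * w (p 0 0) - y (p 0 0)) - x (p 0 0) ^+ 2.
  move=> Up; rewrite /K (gauss_curvature_warped I_open g22_gt0 ode_u ode_g22 Up).
  by rewrite addrK.
have gradK p : U p -> grad G K p = ('D_(delta_mx 0 0) K p) *: delta_mx 0 0.
  move=> Up; rewrite /grad sharp_warped ?g0//.
  rewrite (_ : 'D_(delta_mx 0 1) K p = 0) ?mul0r ?scale0r ?addr0//.
  rewrite (eq_on_derive UO _ Up KE).
  exact: (derive_e1_coord0 (fun s => eps + y s * (2 * w s - y s) - x s ^+ 2)).
have w'E s : I s -> derive1 w s = - (w s * x s * v s / (3 * w s - y s)).
  by move=> Is; have [_] := ode_w s Is; rewrite derive1E.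
split.
- split.
  + by have [] := frame_smooth AF.
  + exact: (frame_space AF).
  + move=> p a Up; rewrite (derive_phi AF _ Up) => Z0.
    have := frame_comb_dot AF (a 0 0) (a 0 1 * r (p 0 0)) 0 0 Up.
    rewrite /= !scale0r !addr0 Z0 !dot50 => -[a0 /esym/eqP a1 _ _].
    move: a1; rewrite mulf_eq0 [r _ == 0]gt_eqF ?r_gt0// orbF => /eqP a1.
    by rewrite (rV2_decomp a) -a0 a1 !scale0r addr0.
  + move=> p a b Up; rewrite !(derive_phi AF _ Up) warped_metricE -(r2 _ Up).
    have [n1 n2 _ _] := unit p Up.
    have [h12 _ _] := (frame_orth AF Up).1.
    rewrite !dot5Dl !dot5Zl !dot5Dr !dot5Zr (dot5C _ (E2' p) (E1' p)) n1 n2 h12.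
    by ring.
- move=> p Up; rewrite metric_trace_warped ?g0//.
  have Hs q (Uq : U q) : H q = w (q 0 0) *: E3' q + cst 0 q *: E4 q.
    by rewrite HE// /cst scale0r addr0.
  have nH (d : 'rV[R]_2) : normal_conn eps G phi (cst d) (mean_curvature eps G phi) p =
      (d 0 0 * derive1 w (p 0 0)) *: E3' p + (d 0 0 * v (p 0 0) * w (p 0 0)) *: E4 p.
    have dwp : is_derive p d (fun q => w (q 0 0)) (d 0 0 * derive1 w (p 0 0)).
      by apply: is_derive_coord; rewrite w'E//; exact: ode_w.
    rewrite (normal_conn_frame (X := cst d) I_open AF r_gt0 r2 Up dwp
      (is_derive_cst (0 : R) p d) Hs).
    by rewrite /cst mulr0 subr0 add0r.
  rewrite !nH !(shape_operator_frame I_open AF r_gt0 r2 ode_r _ _ _ Up).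
  have dw2 d : 'D_d (fun q => mean_curvature_norm eps G phi q ^+ 2) p
      = d 0 0 * (2 * w (p 0 0) * derive1 w (p 0 0)).
    rewrite (@eq_on_derive _ _ UO _ _ (fun q : 'rV[R]_2 => w (q 0 0) * w (q 0 0)) _ _ Up); last first.
      by move=> q Uq; rewrite -/(f q) fE// expr2.
    have dwp : is_derive p d (fun q => w (q 0 0)) (d 0 0 * derive1 w (p 0 0)).
      by apply: is_derive_coord; rewrite w'E//; exact: ode_w.
    have [_ ->] := is_deriveM dwp dwp.
    by rewrite /GRing.scale /=; ring.
  (* The E1-component is a multiple of (3 w - y) w' + w x v. *)
  rewrite /grad sharp_warped ?g0// !dw2 w'E//.
  have wyn := wy_neq0 _ Up; have gn := g0 p Up.
  move: (w (p 0 0)) (x (p 0 0)) (v (p 0 0)) (y (p 0 0)) (g22 (p 0 0)) wyn gn => a b c d e wyn gn.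
  by apply/rowP; elim/forall_ord2; rewrite !mxE /=; field; rewrite ?wyn ?gn.
- have [_ _ _ _ sE4] := frame_smooth AF.
  split; last first.
    move=> p Up; have [_ _ _ n4] := unit p Up; split => //.
    by rewrite E3E// dot5C; have [_ []] := frame_orth AF Up.
  split=> // p Up; have [_ _ _ t4] := frame_tangent AF Up; split=> // a.
  rewrite (derive_phi AF _ Up) dot5Dr !dot5Zr (dot5C _ (E4 p)).
  rewrite (dot5C _ (E4 p) (E2' p)).
  have [ [_ _ ->] [_ -> _] ] := frame_orth AF Up.
  by rewrite !mulr0 addr0.
- split.
  + split.
    * move=> p Up; split.
      - rewrite fE// KE//.
        have := wyx_neq0 _ Up; congr (_ != 0); ring.
      - rewrite HE// scaler_eq0 negb_or w0//=.
        have [_ _ n3 _] := unit p Up; apply/eqP => E30.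
        by move: n3; rewrite E30 dot50 => /esym/eqP; rewrite oner_eq0.
      - by rewrite gradf// scaler_eq0 negb_or delta2_neq0 gt_eqF// dw_gt0.
      - exists (delta_mx 0 0); rewrite A4E// !mxE /= mul1r mul0r scale0r subr0.
        by rewrite scaler_eq0 negb_or delta2_neq0 gt_eqF// x_gt0.
      - by rewrite E2E// scaler_eq0 negb_or delta2_neq0 u_neq0.
    * exact: A3n.
    * move=> p Up B pB.
      have [yw|yw] := eqVneq (y (p 0 0)) (w (p 0 0)); last first.
        by exists p; split; [split=> //; exact: A3n|exact: nbhs_singleton].
      have [|q [Uq Bq ywq]] := y_neq_w_dense I_open Up pB (ode_y _ Up) (ode_w _ Up).
        have wn := w0 p Up; rewrite yw subrr mulr0 sub0r eqr_opp.
        have -> : 3 * w (p 0 0) - w (p 0 0) = 2 * w (p 0 0) by ring.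
        rewrite -subr_eq0 (_ : _ - _ = x (p 0 0) * v (p 0 0) / 2); last by field.
        by rewrite !mulf_neq0 ?v_neq0 ?gt_eqF ?x_gt0// invr_eq0 pnatr_eq0.
      by exists q; split=> //; split=> //; exact: A3n.
  + split; first exact: (flat_normal_bundle_frame I_open AF r_gt0 r2 v_smooth).
    by move=> p Up; rewrite gradf// gradK//; exact: not_free_line.
  + have D1 p : U p -> Dperp E1 E3 p = v (p 0 0) *: E4 p.
      by move=> Up; rewrite DperpE3// /E1 /frame1 mxE /= mul1r.
    have D1n p : U p -> Dperp E1 E3 p != 0.
      by move=> Up; rewrite D1// scaler_eq0 negb_or v_neq0//= E4_neq0.
    split=> //.
      by move=> p Up; rewrite DperpE3// /E2 /frame2 !mxE /= mulr0 mul0r scale0r.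
    have [s0 Is0] := I_neq0; move=> par.
    have Up0 : U (\row_(i < 2) s0) by rewrite /U /strip /= mxE.
    have := D1n _ Up0; rewrite /Dperp [normal_conn _ _ _ _ _ _](_ : _ = 0) ?eqxx//.
    exact: (par _ (delta_mx 0 0 : 'rV[R]_2) Up0).
  + exists (fun p => 2 * w (p 0 0) - y (p 0 0)), (fun p => y (p 0 0)),
      (fun p => x (p 0 0)), (fun p => u (p 0 0)), (fun p => v (p 0 0)).
    split=> p Up; split=> //.
    * split; rewrite A3E// /E1 /E2 /frame1 /frame2 !mxE /=.
        by rewrite mul1r mul0r scale0r addr0.
      by rewrite mulr0 mul0r scale0r add0r mulr1 mulrC scalerA.
    * by rewrite A4E// /E1 /frame1 !mxE /= mul1r mul0r scale0r subr0.
    * rewrite A4E// /E2 /frame2 !mxE /= mulr0 mul0r scale0r sub0r mulr1 scaleNr.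
      by rewrite scalerA mulrC.
    * exact: E2E.
    * have [_ _ _ n4] := unit p Up.
      by rewrite DperpE3// /E1 /frame1 mxE /= mul1r dot5Zl n4 mulr1.
    * exact: fE.
Qed.
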